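(* Let $R=K[G_{k,m-k}]$ be the edge ring of $G_{k,m-k}$. (a) If $k=m-k=3$, then $R$ is inseparable, but not rigid. (b) If $m-k\ge k\ge4$, then $R$ is rigid.
   Context: $K$ is a field of characteristic $0$. $G_{k,m-k}$ is the bipartite graph on parts $U=\{1,\ldots,k\}$ and $V=\{k+1,\ldots,m\}$ with edge set $\{\{i,j\}: i\in U,\ j\in V,\ \{i,j\}\ne\{1,m\}\}$, i.e. the complete bipartite graph $K_{k,m-k}$ with one edge deleted. For a finite simple graph $G$ on $[m]$ with edges $e_1,\ldots,e_n$, $K[G]=K[t_it_j:\{i,j\}\in E(G)]$; with $\delta_1,\ldots,\delta_m$ the canonical basis of $\mathbb{Z}^m$ and $h_k=\delta_i+\delta_j$ for $e_k=\{i,j\}$, $H$ is the semigroup generated by the $h_k$, and $L\subset\mathbb{Z}^n$ is the relation lattice, the kernel of $\mathbb{Z}^n\to\mathbb{Z}^m$, $\epsilon_k\mapsto h_k$. $K[G]=K[H]$. $R$ is rigid if $T^1(R)=0$. Definition of $T^1$: for $v\in\mathbb{Z}^n$ put $f_v=\prod_{v(i)\ge0}x_i^{v(i)}-\prod_{v(i)\le0}x_i^{-v(i)}$ in $S=K[x_1,\ldots,x_n]$ and for $v\in L$ put $h(v)=\sum_{v(i)\ge0}v(i)h_i$. Let $\bigoplus_iR\,dx_i$ be the free graded $R$-module with $\deg dx_i=h_i$, and $U_R$ its submodule generated by $df_v=\sum_iv(i)t^{h(v)-h_i}dx_i$, $v\in L$. With $M^*=\operatorname{Hom}_R(M,R)$,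 $T^1(R)$ is the cokernel of the restriction map $(\bigoplus_iR\,dx_i)^*\to U_R^*$; it is isomorphic to $\operatorname{Ext}^1_R(\Omega_{R/K},R)$. $R$ is inseparable if $L$ is inseparable in the following sense. For a lattice $L$, $I_L=(f_v:v\in L)$; $L$ is saturated if $\mathbb{Z}^n/L$ is torsionfree. Let $\pi_i:S[x_{n+1}]\to S$ be the $K$-algebra map with $\pi_i(x_j)=x_j$ ($j\le n$), $\pi_i(x_{n+1})=x_i$. A saturated $L\subset\mathbb{Z}^n$ is $i$-separable if there is a saturated $L'\subset\mathbb{Z}^{n+1}$ such that (i) $\operatorname{rank}L'=\operatorname{rank}L$; (ii) $\pi_i(I_{L'})=I_L$; (iii) there is a minimal system of generators $f_{w_1},\ldots,f_{w_s}$ of $I_{L'}$ such that $(w_1(n+1),\ldots,w_s(n+1))$ and $(w_1(i),\ldots,w_s(i))$ are linearly independent. $L$ is inseparable if it is not $i$-separable for any $i$. *)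

(* Defs.v *)
From HB Require Import structures.
From mathcomp Require Import all_boot all_order all_algebra.
From mathcomp Require Import boolp functions.
From mathcomp.multinomials Require Import mpoly.

Set Implicit Arguments.
Unset Strict Implicit.
Unset Printing Implicit Defensive.

Import Order.TTheory GRing.Theory Num.Theory.
Local Open Scope quotient_scope.
Local Open Scope ring_scope.

Section Span.
Variables (R : pzRingType) (V : lmodType R).

Definition span_of (A : V -> Prop) : {pred V} := fun v =>
  `[< exists s : seq (R * V),
        (forall x, x \in s -> A x.2) /\ v = \sum_(x <- s) x.1 *: x.2 >].

Lemma span_of_submod A : submod_closed (span_of A).
Proof.
split=> [|a u v].
  by apply/asboolP; exists [::]; rewrite big_nil.
move=> /asboolP[s [sA ->]] /asboolP[t [tA ->]]; apply/asboolP.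
exists ([seq (a * x.1, x.2) | x <- s] ++ t); split=> [x|].
  by rewrite mem_cat => /orP[/mapP[y /sA ? ->]|/tA].
rewrite big_cat big_map scaler_sumr; congr (_ + _).
by apply: eq_bigr => x _; rewrite scalerA.
Qed.

HB.instance Definition _ A :=
  GRing.isSubmodClosed.Build R V (span_of A) (span_of_submod A).

End Span.

Section Submodule.
Variables (R : pzRingType) (V : lmodType R) (P : submodClosed V).

Record submodule := Submodule { submodule_val :> V; _ : submodule_val \in P }.

HB.instance Definition _ := [isSub for submodule_val].
HB.instance Definition _ := [Choice of submodule by <:].
HB.instance Definition _ := [SubChoice_isSubLmodule of submodule by <:].

End Submodule.

Section Dual.
Variables (R : comNzRingType) (M : lmodType R).

Definition linear_pred : {pred M -> R^o} := fun f => `[< linear f >].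

Lemma linear_pred_submod : submod_closed linear_pred.
Proof.
split=> [|a f g /asboolP fl /asboolP gl].
  by apply/asboolP => b x y; rewrite /GRing.zero /= scaler0 addr0.
apply/asboolP => b x y.
have E z : (a *: f + g) z = a *: f z + g z by [].
by rewrite !E fl gl !scalerDr !scalerA addrACA (mulrC a b).
Qed.

HB.instance Definition _ :=
  GRing.isSubmodClosed.Build R (M -> R^o) linear_pred linear_pred_submod.

Definition dual : Type := submodule linear_pred.
HB.instance Definition _ := GRing.Lmodule.on dual.

Lemma dual_linear (f : dual) : linear (submodule_val f).
Proof. by case: f => f /= /asboolP. Qed.

End Dual.

Section Restriction.
Variables (R : comNzRingType) (V : lmodType R) (P : submodClosed V).

Lemma restr_linear (f : dual V) :
  (fun u : submodule P => submodule_val f (\val u)) \in @linear_pred R (submodule P).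
Proof. by apply/asboolP => a x y; rewrite linearP dual_linear. Qed.

Definition restr (f : dual V) : dual (submodule P) := Submodule (restr_linear f).

Lemma restr_is_linear : linear restr.
Proof. by move=> a f g; apply: val_inj. Qed.

HB.instance Definition _ :=
  GRing.isLinear.Build R (dual V) (dual (submodule P)) *:%R restr
    restr_is_linear.

End Restriction.

Section Cokernel.
Variables (R : pzRingType) (M N : lmodType R) (f : {linear M -> N}).

Definition im_pred : {pred N} := fun y => `[< exists x, y = f x >].

Lemma im_pred_zmod : zmod_closed im_pred.
Proof.
split; first by apply/asboolP; exists 0; rewrite linear0.
move=> _ _ /asboolP[x ->] /asboolP[y ->]; apply/asboolP.
by exists (x - y); rewrite linearB.
Qed.

HB.instance Definition _ := GRing.isZmodClosed.Build N im_pred im_pred_zmod.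

(* Only the underlying abelian group of N / im f is kept. *)
Definition coker : zmodType := Quotient.quot im_pred.

End Cokernel.

Section Lattice.
Variable n : nat.

Definition torsionfree (V : zmodType) : Prop :=
  forall (x : V) (c : nat), (0 < c)%N -> x *+ c = 0 -> x = 0.

Definition saturated (L : zmodClosed 'rV[int]_n) : Prop :=
  torsionfree (Quotient.quot L).

End Lattice.

Definition rows_indep (r n : nat) (B : 'M[int]_(r, n)) : Prop :=
  forall u : 'rV[int]_r, u *m B = 0 -> u = 0.

(* The rank of a subgroup of Z^n is the maximal number (at most n) of
   Z-linearly independent elements. *)
Definition lattice_rank (n : nat) (L : zmodClosed 'rV[int]_n) : nat :=
  \max_(r < n.+1 | `[< exists B : 'M[int]_(r, n),
                        (forall j, row j B \in L) /\ rows_indep B >]) r.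

Section LatticeIdeal.
Variables (K : fieldType) (n : nat).

Definition binom (v : 'rV[int]_n) : {mpoly K[n]} :=
  \prod_(i < n | 0 <= v 0 i) 'X_i ^+ absz (v 0 i)
  - \prod_(i < n | v 0 i <= 0) 'X_i ^+ absz (v 0 i).

Definition ideal_of (A : {mpoly K[n]} -> Prop) : {pred {mpoly K[n]}} :=
  @span_of {mpoly K[n]} {mpoly K[n]}^o A.

Definition lattice_ideal (L : zmodClosed 'rV[int]_n) : {pred {mpoly K[n]}} :=
  ideal_of (fun f => exists2 v, v \in L & f = binom v).

Definition generates (s : nat) (f : 'I_s -> {mpoly K[n]}) (J : {set 'I_s})
    (I : {pred {mpoly K[n]}}) : Prop :=
  ideal_of (fun g => exists2 j, j \in J & g = f j) =i I.

(* Minimality is with respect to inclusion: no proper subfamily generates. *)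
Definition min_generators (s : nat) (f : 'I_s -> {mpoly K[n]})
    (I : {pred {mpoly K[n]}}) : Prop :=
  generates f setT I /\
  forall J : {set 'I_s}, J \proper setT -> ~ generates f J I.

End LatticeIdeal.

Arguments lattice_ideal K {n} L.

Section Separability.
Variables (K : fieldType) (n : nat).

(* Coordinate n+1 of Z^{n+1} is ord_max; coordinate i <= n is lift ord_max i. *)
Definition merge (i : 'I_n) : n.+1.-tuple {mpoly K[n]} :=
  [tuple if unlift ord_max j is Some j' then 'X_j' else 'X_i | j < n.+1].

Definition separable (L : zmodClosed 'rV[int]_n) (i : 'I_n) : Prop :=
  exists L' : zmodClosed 'rV[int]_n.+1,
    [/\ saturated L',
        lattice_rank L' = lattice_rank L,
        (forall g, g \in lattice_ideal K L <->
           exists2 g', g' \in lattice_ideal K L' & g = g' \mPo merge i) &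
        exists (s : nat) (w : 'I_s -> 'rV[int]_n.+1),
          [/\ (forall l, w l \in L'),
              min_generators (fun l => binom K (w l)) (lattice_ideal K L') &
              rows_indep (col_mx (\row_(l < s) w l 0 ord_max)
                                 (\row_(l < s) w l 0 (lift ord_max i)))]].

Definition inseparable (L : zmodClosed 'rV[int]_n) : Prop :=
  forall i : 'I_n, ~ separable L i.

End Separability.

Section RelationLattice.
Variables (m n : nat) (h : 'I_n -> 'X_{1..m}).

Definition hvec (i : 'I_n) : 'rV[int]_m := \row_(j < m) (h i j)%:Z.

Definition rel_lattice : {pred 'rV[int]_n} :=
  fun v => \sum_(i < n) v 0 i *: hvec i == 0.

Lemma rel_lattice_zmod : zmod_closed rel_lattice.
Proof.
split=> [|u v].
  by apply/eqP; rewrite big1 // => i _; rewrite mxE scale0r.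
move=> /eqP hu /eqP hv; apply/eqP.
under eq_bigr do rewrite !mxE scalerBl.
by rewrite sumrB hu hv subr0.
Qed.

HB.instance Definition _ :=
  GRing.isZmodClosed.Build 'rV[int]_n rel_lattice rel_lattice_zmod.

Lemma rel_lattice_saturated : saturated rel_lattice.
Proof.
move=> x c c0; rewrite -[x]reprK; move: (repr x) => v.
pose p : {additive 'rV[int]_n -> Quotient.quot rel_lattice} := \pi.
change (p v *+ c = 0 -> p v = 0); rewrite -raddfMn -(raddf0 p) => /eqP.
rewrite -Quotient.idealrBE subr0 => /eqP vc; apply/eqP.
rewrite -Quotient.idealrBE subr0; apply/eqP/eqP.
have : (\sum_(i < n) v 0 i *: hvec i) *+ c == 0.
  by rewrite -sumrMnl -[X in _ == X]vc; apply/eqP/eq_bigr => i _;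
     rewrite mulmxnE scalerMnl.
move=> /eqP/rowP E; apply/eqP/rowP => j; move/(_ j)/eqP: E.
by rewrite mulmxnE !mxE mulrn_eq0 eqn0Ngt c0 => /eqP.
Qed.

Definition hdeg (v : 'rV[int]_n) : 'X_{1..m} :=
  (\sum_(i < n | (0 <= v 0 i)%R) h i *+ absz (v 0%R i))%MM.

Lemma hdegN v : v \in rel_lattice -> hdeg (- v) = hdeg v.
Proof.
move=> /eqP/rowP vL; apply/mnmP => j; apply/eqP.
rewrite -eqz_nat !mnm_sumE !(big_morph Posz PoszD (erefl _)) -subr_eq0.
rewrite -oppr_eq0 opprB big_mkcond [X in _ - X]big_mkcond -sumrB.
move/(_ j): vL; rewrite mxE summxE => E; apply/eqP; rewrite -[RHS]E.
apply: eq_bigr => i _; rewrite !mxE !mulmnE oppr_ge0 !PoszM.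
case: (v 0 i) => [[|a]|a] /=; rewrite ?mulr0 ?mul0r ?subr0 1?mulrC //.
by rewrite NegzE sub0r mulNr mulrC.
Qed.

End RelationLattice.

Section ToricRing.
Variables (K : fieldType) (m n : nat) (h : 'I_n -> 'X_{1..m}).

(* K[t^{h_1}, ..., t^{h_n}], as the image of the evaluation x_i |-> t^{h_i}. *)
Definition toric_pred : {pred {mpoly K[m]}} := fun q =>
  `[< exists p : {mpoly K[n]}, q = p \mPo [tuple 'X_[h i] | i < n] >].

Lemma toric_pred_subring : subring_closed toric_pred.
Proof.
split; first by apply/asboolP; exists 1; rewrite rmorph1.
  move=> _ _ /asboolP[p ->] /asboolP[q ->]; apply/asboolP.
  by exists (p - q); rewrite raddfB.
move=> _ _ /asboolP[p ->] /asboolP[q ->]; apply/asboolP.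
by exists (p * q); rewrite rmorphM.
Qed.

HB.instance Definition _ :=
  GRing.isSubringClosed.Build {mpoly K[m]} toric_pred toric_pred_subring.

Record toric_ring :=
  ToricRing { toric_val :> {mpoly K[m]}; _ : toric_val \in toric_pred }.

HB.instance Definition _ := [isSub for toric_val].
HB.instance Definition _ := [Choice of toric_ring by <:].
HB.instance Definition _ := [SubChoice_isSubComNzRing of toric_ring by <:].

(* The free module with basis dx_1, ..., dx_n is 'rV[toric_ring]_n.  For v in
   the lattice the element below does lie in the toric ring, so that the default
   value 0 of insubd plays no role: see [val_dbinom]. *)
Definition dbinom (v : 'rV[int]_n) : 'rV[toric_ring]_n :=
  \row_(i < n) insubd (0 : toric_ring) ('X_[hdeg h v - h i] *~ v 0 i).

Lemma toric_monomial (a : 'I_n -> nat) :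
  'X_[\big[mnm_add/mnm0]_(i < n) (h i *+ a i)%MM] \in toric_pred.
Proof.
apply/asboolP; exists 'X_[ [multinom a i | i < n] ].
rewrite comp_mpolyX (big_morph _ (@mpolyXD _ _) (@mpolyX0 _ _)).
by apply: eq_bigr => i _; rewrite tnth_mktuple mnmE mpolyXn.
Qed.

Lemma val_dbinom (v : 'rV[int]_n) (i : 'I_n) : v \in rel_lattice h ->
  (v 0 i != 0 -> (h i <= hdeg h v)%MM) /\
  \val (dbinom v 0 i) = 'X_[hdeg h v - h i] *~ v 0 i.
Proof.
have pos (u : 'rV[int]_n) : 0 < u 0 i ->
    (h i <= hdeg h u)%MM /\ 'X_[hdeg h u - h i] \in toric_pred.
  move=> ui; pose w : 'rV[int]_n := u - delta_mx 0 i.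
  have hE : hdeg h u = (hdeg h w + h i)%MM.
    apply/mnmP => j; rewrite mnmDE !mnm_sumE.
    rewrite big_mkcond [in RHS]big_mkcond (bigD1 i) //= [in RHS](bigD1 i) //=.
    have wi : w 0 i = u 0 i - 1 by rewrite !mxE !eqxx.
    rewrite wi subr_ge0 -gtz0_ge1 ui ltW // !mulmnE addnAC; congr (_ + _)%N.
      by case: (u 0 i) ui => [[|a]|a] //= _; rewrite subn1 mulnSr.
    apply: eq_bigr => l /negPf li.
    by rewrite !mulmnE !mxE li andbF subr0.
  rewrite hE; split; first exact: lem_addl.
  rewrite addmK /hdeg big_mkcond /=.
  rewrite (eq_bigr (fun l => h l *+ (if (0 <= w 0 l)%R then absz (w 0%R l) else 0%N))%MM) ?toric_monomial //.
  by move=> l _; case: ifP => // _; rewrite mulm0n.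
move=> vL; rewrite mxE; case: (ltgtP (v 0 i) 0) => [vi|/pos[le_h inR]|->].
- have [|le_h inR] := pos (- v); first by rewrite mxE oppr_gt0.
  move: le_h inR; rewrite hdegN // => le_h inR; split=> //.
  by rewrite insubdK // rpredMz.
- by split=> //; rewrite insubdK // rpredMz.
- by rewrite mulr0z insubdK ?rpred0.
Qed.

Definition U_R_pred : {pred 'rV[toric_ring]_n} :=
  span_of (fun u => exists2 v, v \in rel_lattice h & u = dbinom v).

HB.instance Definition _ := GRing.SubmodClosed.on U_R_pred.

Definition U_R : lmodType toric_ring := submodule U_R_pred.

Definition T1 : zmodType :=
  coker (@restr toric_ring 'rV[toric_ring]_n U_R_pred).

Definition toric_rigid : Prop := forall x : T1, x = 0.

Definition toric_inseparable : Prop := inseparable K (rel_lattice h).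

End ToricRing.

Section EdgeRing.
Variable m : nat.

Record sgraph := SGraph {
  edges : {set {set 'I_m}};
  edges_card2 : forall e, e \in edges -> #|e| = 2 }.

(* h_e = delta_i + delta_j for e = {i, j}, the edges being numbered by
   enum_val; toric_ring K (edge_gens G) is the edge ring K[G]. *)
Definition edge_gens (G : sgraph) (e : 'I_#|edges G|) : 'X_{1..m} :=
  (\sum_(j in enum_val e) U_(j))%MM.

Definition edge_ring_rigid (K : fieldType) (G : sgraph) : Prop :=
  toric_rigid K (@edge_gens G).

Definition edge_ring_inseparable (K : fieldType) (G : sgraph) : Prop :=
  toric_inseparable K (@edge_gens G).

(* Vertex i of {1, ..., m} is the ordinal i - 1 of 'I_m. *)
Definition bip_edges (k : nat) : {set {set 'I_m}} :=
  [set [set i; j] | i in [set i : 'I_m | (i < k)%N],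
                    j in [set j : 'I_m | (k <= j)%N]
                  & ~~ ((i == 0%N :> nat) && (j == m.-1 :> nat))].

Lemma bip_edges_card2 k e : e \in bip_edges k -> #|e| = 2.
Proof.
case/imset2P => i j; rewrite !inE => ik /andP[kj _] ->.
by rewrite cards2 -val_eqE /= ltn_eqF // (leq_trans ik kj).
Qed.

End EdgeRing.

(* The graph G_{k,m-k}. *)
Definition bip_minus_edge (k m : nat) : sgraph m :=
  SGraph (@bip_edges_card2 m k).

(* Main.v *)
(** A homomorphism [phi : U_R -> R] is determined, degree by degree, by additive
functions on the relation lattice [L]: for [a] in Z^m the coefficient of
[phi (df_v)] at [t^{a + h(v)}] is additive in [v] and vanishes when [a + h(v)]
is not in the semigroup [H].  It comes from the free module exactly when it has
the form [v |-> sum_e c_e v(e)] with [c_e = 0] whenever [a + h_e] is not in [H].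

For [G_{k,m-k}] the semigroup [H] is cut out by [z >= 0], equality of the two
coordinate sums, and [z_1 + z_m <= sum of the U-coordinates].  For a base row
[i <> 1] and a base column [j <> m], every [v] in [L] equals
[sum_e v(e) cyc_e], where [cyc_e] is the 4-cycle through [e] on the rows of [e]
and [i] and the columns of [e] and [j].  So [c_e] can be taken to be the value
on [cyc_e], corrected by a potential [al(row e) + be(col e)].  If [k, m-k >= 4]
there is always a base avoiding [1], [m] and the (at most two relevant) negative
coordinates of [a], which settles every degree.  For [k = m-k = 3] this fails in
the degree [a = (1,-1,-1;0,0,-1)], and [u |-> (t_1/t_3) u_{26}] is a nontrivial
class.

If [L] were [i]-separable through [L'], then merging the two coordinates would
be a bijection [L' -> L], and the lifts of lattice vectors [v] with
[h(v) - h_i] not in [H] would vanish at both coordinates; since [L] is spanned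
by one vector together with such [v]'s, the two coordinates would be
proportional on [L']. *)

From HB Require Import structures.
From mathcomp Require Import all_boot all_order all_algebra zify.
From mathcomp Require Import boolp functions.
From mathcomp.multinomials Require Import mpoly.
Require Import Defs.

Set Implicit Arguments.
Unset Strict Implicit.
Unset Printing Implicit Defensive.

Import Order.TTheory GRing.Theory Num.Theory.

(** * Graded pieces of T1 *)

Section CokernelDual.
Local Open Scope ring_scope.

Lemma coker_eq0P (R : pzRingType) (M N : lmodType R) (f : {linear M -> N}) :
  (forall x : coker f, x = 0) <-> (forall y : N, exists x, y = f x).
Proof.
pose p : {additive N -> Quotient.quot (im_pred f)} := \pi%qT.
have pE y : (p y == 0) = (y \in im_pred f).
  by rewrite -(raddf0 p) -Quotient.idealrBE subr0.
split=> H y.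
  by have /eqP := H (p y); rewrite pE => /asboolP.
rewrite -[y]reprK; apply/eqP; change (p (repr y) == 0); rewrite pE.
exact/asboolP.
Qed.

(** Each element of P is a combination of elements of A, and linearity does the rest. Since A is
    contained in P, [insubd 0 x] is x itself and the default 0 is never returned. *)
Lemma dual_ext (R : comNzRingType) (V : lmodType R) (P : submodClosed V)
    (A : V -> Prop) (f g : dual (submodule P)) :
    (forall x, A x -> x \in P) -> {subset P <= span_of A} ->
    (forall x, A x -> submodule_val f (insubd 0 x) =
                      submodule_val g (insubd 0 x)) ->
  f = g.
Proof.
move=> AP PA fg; apply: val_inj; apply/funext => -[x xP] /=.
have /PA/asboolP[s [sA xE]] := xP.
have -> : Submodule xP = \sum_(y <- s) y.1 *: insubd 0 y.2.
  apply: val_inj; rewrite raddf_sum /= xE big_seq [RHS]big_seq.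
  apply: eq_bigr => y /sA/AP yP.
  change (y.1 *: y.2 = y.1 *: \val (insubd (0 : submodule P) y.2)).
  by rewrite insubdK.
pose F (d : dual (submodule P)) : submodule P -> R^o := submodule_val d.
have E (d : dual (submodule P)) :
    F d (\sum_(y <- s) y.1 *: insubd 0 y.2) =
    \sum_(y <- s) y.1 *: F d (insubd 0 y.2).
  pose HF := GRing.isLinear.Build _ _ _ _ (F d) (dual_linear d).
  pose Fl : {linear submodule P -> R^o} := HB.pack (F d) HF.
  rewrite -[LHS]/(Fl _) (raddf_sum Fl); apply: eq_bigr => y _.
  exact: (linearZ_LR Fl).
rewrite -/(F f _) -/(F g _) !E big_seq [RHS]big_seq.
by apply: eq_bigr => y /sA/fg; rewrite /F => ->.
Qed.

Lemma linear_pred_subproof (R : comNzRingType) (M : lmodType R) (f : M -> R^o) :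
  linear f -> f \in @linear_pred R M.
Proof. by move=> fl; apply/asboolP. Qed.

Definition dual_of (R : comNzRingType) (M : lmodType R) (f : M -> R^o)
  (fl : linear f) : dual M := Submodule (linear_pred_subproof fl).

Lemma row_form_subproof (R : comNzRingType) (n : nat) (r : 'I_n -> R) :
  linear (fun u : 'rV[R]_n => \sum_i u 0 i * r i : R^o).
Proof.
move=> a u v; rewrite scaler_sumr -big_split; apply: eq_bigr => i _.
by rewrite !mxE mulrDl -mulrA.
Qed.

Definition row_form (R : comNzRingType) (n : nat) (r : 'I_n -> R) :
  dual 'rV[R]_n := @dual_of R 'rV[R]_n _ (row_form_subproof r).

Lemma dual_rowE (R : comNzRingType) (n : nat) (f : dual 'rV[R]_n) u :
  submodule_val f u = \sum_i u 0 i * submodule_val f (delta_mx 0 i).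
Proof.
pose HF := GRing.isLinear.Build _ _ _ _ (submodule_val f) (dual_linear f).
pose F : {linear 'rV[R]_n -> R^o} := HB.pack (submodule_val f) HF.
rewrite -[LHS]/(F u) [u in LHS]row_sum_delta (raddf_sum F).
by apply: eq_bigr => i _; apply: (linearZ_LR F).
Qed.

Lemma restrE (R : comNzRingType) (V : lmodType R) (P : submodClosed V)
    (f : dual V) (x : submodule P) :
  submodule_val (restr P f) x = submodule_val f (\val x).
Proof. by []. Qed.

End CokernelDual.

(** * Coefficients at integer exponent vectors *)

Section IntegerExponents.
Local Open Scope ring_scope.
Variables (K : fieldType) (m : nat).
Implicit Types (p q : {mpoly K[m]}) (b c : 'X_{1..m}) (z : 'rV[int]_m).

Definition mnmz b : 'rV[int]_m := \row_j (b j)%:Z.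

Lemma mnmzD b c : mnmz (b + c)%MM = mnmz b + mnmz c.
Proof. by apply/rowP => j; rewrite !mxE mnmDE PoszD. Qed.

Lemma mnmz_inj : injective mnmz.
Proof. by move=> b c /rowP E; apply/mnmP => j; have := E j; rewrite !mxE => -[]. Qed.

Lemma mnmzP z : (forall j, 0 <= z 0 j) -> {b | z = mnmz b}.
Proof.
move=> z0; exists [multinom absz (z 0%R j) | j < m].
by apply/rowP => j; rewrite mxE mnmE gez0_abs.
Qed.

(** Exponents range over all of Z^m, with value 0 outside N^m, so that degrees a + h(v) with
    arbitrary integer a can be handled uniformly. *)
Definition zcoeff z p : K :=
  if [forall j, 0 <= z 0 j] then p@_[multinom absz (z 0%R j) | j < m] else 0.

Lemma zcoeff_mnmz p b : zcoeff (mnmz b) p = p@_b.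
Proof.
rewrite /zcoeff ifT; last by apply/forallP => j; rewrite mxE.
by congr (_@__); apply/mnmP => j; rewrite mnmE mxE.
Qed.

Lemma zcoeff_neg p z j : z 0 j < 0 -> zcoeff z p = 0.
Proof.
by move=> zj; rewrite /zcoeff ifF //; apply/forallP => /(_ j); rewrite leNgt zj.
Qed.

Lemma zcoeff_is_linear z : linear_for *%R (zcoeff z).
Proof.
move=> a p q; rewrite /zcoeff; case: ifP => _; last by rewrite mulr0 addr0.
by rewrite mcoeffD mcoeffZ.
Qed.

HB.instance Definition _ z :=
  GRing.isLinear.Build K {mpoly K[m]} K *%R (zcoeff z) (zcoeff_is_linear z).

Lemma zcoeffX b z : zcoeff z 'X_[b] = (mnmz b == z)%:R.
Proof.
have [/forallP z0|] := boolP [forall j, 0 <= z 0 j].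
  have [c ->] := mnmzP z0.
  by rewrite zcoeff_mnmz mcoeffX (inj_eq mnmz_inj).
rewrite negb_forall => /existsP[j]; rewrite -ltNge => zj.
rewrite (zcoeff_neg _ zj); case: eqP => // zE.
by move: zj; rewrite -zE mxE.
Qed.

(** This covers the case where z has a negative entry but z + b has none: the exponent z + b is then
    not reached by any monomial of p times t^b. *)
Lemma zcoeffMX p b z : zcoeff (z + mnmz b) (p * 'X_[b]) = zcoeff z p.
Proof.
rewrite [p]mpolyE mulr_suml.
rewrite (raddf_sum (zcoeff (z + mnmz b))) (raddf_sum (zcoeff z)) /=.
apply: eq_bigr => c _; rewrite -scalerAl -mpolyXD.
rewrite !linearZ_LR /= !zcoeffX mnmzD.
by rewrite (inj_eq (addIr _)).
Qed.

Lemma zcoeffP p q : (forall z, zcoeff z p = zcoeff z q) -> p = q.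
Proof. by move=> E; apply/mpolyP => b; rewrite -!zcoeff_mnmz. Qed.

Lemma zcoeff_neq0 p z : zcoeff z p != 0 -> exists2 b, b \in msupp p & z = mnmz b.
Proof.
have [/forallP z0|] := boolP [forall j, 0 <= z 0 j]; last first.
  rewrite negb_forall => /existsP[j]; rewrite -ltNge => zj.
  by rewrite (zcoeff_neg _ zj) eqxx.
have [b ->] := mnmzP z0.
by rewrite zcoeff_mnmz -mcoeff_msupp; exists b.
Qed.

End IntegerExponents.

Section AdditiveOn.
Local Open Scope ring_scope.
Variables (n : nat) (L : zmodClosed 'rV[int]_n) (V : zmodType).

(** Additivity is demanded on L only: the functions it is applied to are total and, being built with
    [insubd], carry no meaning off the lattice. *)
Definition additive_on (lam : 'rV[int]_n -> V) : Prop :=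
  {in L &, {morph lam : u v / u + v}}.

Variable lam : 'rV[int]_n -> V.
Hypothesis lamD : additive_on lam.

Lemma additive_on0 : lam 0 = 0.
Proof.
have := lamD (rpred0 L) (rpred0 L); rewrite addr0 => E.
by apply: (addrI (lam 0)); rewrite addr0.
Qed.

Lemma additive_onN u : u \in L -> lam (- u) = - lam u.
Proof.
move=> uL; apply: (addrI (lam u)).
by rewrite -lamD ?rpredN // !subrr additive_on0.
Qed.

Lemma additive_onZ (x : int) u : u \in L -> lam (x *: u) = lam u *~ x.
Proof.
move=> uL; rewrite -[x]intz scaler_int intz.
have nat_case k : lam (u *+ k) = lam u *+ k.
  elim: k => [|k IH]; first by rewrite !mulr0n additive_on0.
  by rewrite !mulrS lamD ?rpredMn // IH.
case: x => k; first exact: nat_case.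
by rewrite NegzE !mulrNz additive_onN ?rpredMn // -!pmulrn nat_case.
Qed.

Lemma additive_on_sum (I : Type) (r : seq I) (x : I -> int) (g : I -> 'rV[int]_n) :
    (forall i, g i \in L) ->
  lam (\sum_(i <- r) x i *: g i) = \sum_(i <- r) lam (g i) *~ x i.
Proof.
move=> gL; elim: r => [|i r IH]; first by rewrite !big_nil additive_on0.
have gZ j : x j *: g j \in L by rewrite -[x j]intz scaler_int rpredMz.
by rewrite !big_cons lamD ?rpred_sum // additive_onZ // IH.
Qed.

End AdditiveOn.

(** * Exponents of the toric ring *)

Section ToricExponents.
Local Open Scope ring_scope.
Variables (K : fieldType) (m n : nat) (h : 'I_n -> 'X_{1..m}).

Definition in_semigroup (z : 'rV[int]_m) : Prop :=
  exists u : 'I_n -> nat, z = \sum_i (u i)%:Z *: hvec h i.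

Lemma mnmz_sum (u : 'I_n -> nat) :
  mnmz (\sum_i h i *+ u i)%MM = \sum_i (u i)%:Z *: hvec h i.
Proof.
apply/rowP => j; rewrite mxE mnm_sumE summxE (big_morph Posz PoszD (erefl _)).
by apply: eq_bigr => i _; rewrite !mxE mulmnE PoszM mulrC.
Qed.

Lemma toric_predZ (a : K) p : p \in toric_pred h -> a *: p \in toric_pred h.
Proof.
by move=> /asboolP[q ->]; apply/asboolP; exists (a *: q); rewrite comp_mpolyZ.
Qed.

(** The evaluation sends monomials to monomials with exponent in the semigroup, so membership can be
    tested on the support. *)
Lemma toric_predP (p : {mpoly K[m]}) :
  p \in toric_pred h <-> forall b, b \in msupp p -> in_semigroup (mnmz b).
Proof.
split=> [/asboolP[q ->] b|pH].
  rewrite mcoeff_msupp comp_mpolyE raddf_sum /=.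
  have E (u : 'X_{1..n}) : (\prod_i tnth [tuple 'X_[K, h j] | j < n] i ^+ u i) =
             'X_[(\sum_i h i *+ u i)%MM].
    rewrite (big_morph _ (@mpolyXD _ _) (@mpolyX0 _ _)).
    by apply: eq_bigr => i _; rewrite tnth_mktuple mpolyXn.
  have [/hasP[u _ /eqP <-] _|/hasPn H] :=
      boolP (has (fun u : 'X_{1..n} => (\sum_i h i *+ u i)%MM == b) (msupp q)).
    by exists u; rewrite mnmz_sum.
  rewrite big_seq big1 ?eqxx // => u /H; rewrite E mcoeffZ mcoeffX => /negPf ->.
  by rewrite mulr0.
rewrite [p]mpolyE big_seq; apply: rpred_sum => b bp; have [u] := pH b bp.
rewrite -mnmz_sum => /mnmz_inj {bp}->.
exact/toric_predZ/toric_monomial.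
Qed.

Lemma toric_predX b : in_semigroup (mnmz b) -> 'X_[K, b] \in toric_pred h.
Proof. by move=> bH; apply/toric_predP => c; rewrite msuppX inE => /eqP ->. Qed.

Lemma mnmz_U (i : 'I_n) : mnmz (h i) = hvec h i.
Proof. by []. Qed.

Lemma hdegE (v : 'rV[int]_n) :
  hdeg h v = (\sum_i h i *+ (if (0 <= v 0 i)%R then absz (v 0%R i) else 0%N))%MM.
Proof.
rewrite /hdeg big_mkcond; apply: eq_bigr => i _.
by case: ifP => // _; rewrite mulm0n.
Qed.

Lemma hdeg_in_semigroup (v : 'rV[int]_n) : in_semigroup (mnmz (hdeg h v)).
Proof. by rewrite hdegE mnmz_sum; eexists. Qed.

(** It is used at the exponents [hdeg h v], which lie in the semigroup, so the default 0 is not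
    reached there. *)
Definition tmon (b : 'X_{1..m}) : toric_ring K h := insubd 0 'X_[b].

Lemma val_tmon_hdeg v : \val (tmon (hdeg h v)) = 'X_[hdeg h v].
Proof. by rewrite insubdK //; apply/toric_predX/hdeg_in_semigroup. Qed.

(** Multiplication by t^{h_i} removes the truncated subtraction from the exponent; identities in the
    free module are checked in this form. *)
Lemma mulX_dbinom v i : v \in rel_lattice h ->
  'X_[h i] * \val (dbinom K h v 0 i) = 'X_[hdeg h v] *~ v 0 i.
Proof.
move=> vL; have [le_h ->] := val_dbinom K i vL.
have [->|vi] := eqVneq (v 0 i) 0; first by rewrite !mulr0z mulr0.
by rewrite mulrzAr -mpolyXD addmC submK // le_h.
Qed.

Lemma dbinom_U_R v : v \in rel_lattice h -> dbinom K h v \in @U_R_pred K m n h.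
Proof.
move=> vL; apply/asboolP; exists [:: (1, dbinom K h v)].
split=> [x|]; last by rewrite big_seq1 scale1r.
by rewrite inE => /eqP -> /=; exists v.
Qed.

End ToricExponents.

(** * Surjectivity of the restriction map, degree by degree *)

Section Rigidity.
Local Open Scope ring_scope.
Variables (K : fieldType) (m n : nat) (h : 'I_n -> 'X_{1..m}).
Notation R := (toric_ring K h).
Notation L := (rel_lattice h).

Section Homogeneous.
Variable phi : dual (U_R K h).

Definition dual_dbinom (v : 'rV[int]_n) : {mpoly K[m]} :=
  \val (submodule_val phi (insubd 0 (dbinom K h v))).

(** Additivity of t^{-h(v)} df_v with denominators cleared. The relation holds in U_R entry by
    entry, both sides being (u_i + v_i) t^{h(u)+h(v)+h(u+v)-h_i}, and [phi] is then applied to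
    it. *)
Lemma dual_dbinomD u v : u \in L -> v \in L ->
  'X_[hdeg h v] * 'X_[hdeg h (u + v)] * dual_dbinom u +
  'X_[hdeg h u] * 'X_[hdeg h (u + v)] * dual_dbinom v =
  'X_[hdeg h u] * 'X_[hdeg h v] * dual_dbinom (u + v).
Proof.
move=> uL vL; have uvL : u + v \in L by rewrite rpredD.
pose T w := tmon K h (hdeg h w).
have VT w : \val (T w) = 'X_[hdeg h w] by apply: val_tmon_hdeg.
pose D w : U_R K h := insubd 0 (dbinom K h w).
have VD w : w \in L -> \val (D w) = dbinom K h w.
  by move=> wL; rewrite insubdK //; apply: dbinom_U_R.
have E : (T v * T (u + v)) *: D u + (T u * T (u + v)) *: D v =
         (T u * T v) *: D (u + v).
  apply: val_inj.
  change ((T v * T (u + v)) *: \val (D u) + (T u * T (u + v)) *: \val (D v) =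
          (T u * T v) *: \val (D (u + v))).
  rewrite !VD //; apply/rowP => i; rewrite [LHS]mxE; apply: val_inj.
  have X0 : 'X_[K, h i] != 0 by rewrite -msupp_eq0 msuppX.
  apply: (mulfI X0).
  have SE a b (x : 'rV[R]_n) : \val (((T a * T b) *: x) 0 i) =
      'X_[hdeg h a] * 'X_[hdeg h b] * \val (x 0 i).
    by rewrite mxE -!VT.
  have VDD (x y : R) : \val (x + y) = \val x + \val y by [].
  have mulC3 (p q s : {mpoly K[m]}) : q * s * p = p * q * s.
    by rewrite mulrC mulrA.
  rewrite VDD !SE mulrDr !(mulrCA 'X_[h i]) !mulX_dbinom // [in RHS]mxE.
  move: 'X_[hdeg h u] 'X_[hdeg h v] 'X_[hdeg h (u + v)] => p q s.
  by rewrite !mulrzAr mulrzDr mulC3 [p * s * q]mulrAC.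
pose F (x : U_R K h) := \val (submodule_val phi x) : {mpoly K[m]}.
have F0 : F 0 = 0.
  have E0 := congr1 val (dual_linear phi 1 0 0); rewrite !scale1r addr0 in E0.
  by apply: (addrI (F 0)); rewrite addr0; apply: esym.
have FD a x y : F (a *: x + y) = \val a * F x + F y.
  by rewrite /F dual_linear.
have FZ a x : F (a *: x) = \val a * F x.
  by rewrite -[a *: x]addr0 FD F0 addr0.
have VTT a b : \val (T a * T b) = 'X_[hdeg h a] * 'X_[hdeg h b].
  by rewrite -!VT.
by have := congr1 F E; rewrite FD !FZ !VTT.
Qed.

Definition dual_coeff (a : 'rV[int]_m) (v : 'rV[int]_n) : K :=
  zcoeff (a + mnmz (hdeg h v)) (dual_dbinom v).

(* Over the fraction field t^{-h(v)} df_v is additive in v, so the coefficients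
   of phi(df_v) in degree a + h(v) are additive in v. *)
Lemma dual_coeff_additive a : additive_on L (dual_coeff a).
Proof.
move=> u v uL vL; pose z := a + mnmz (hdeg h u + hdeg h v + hdeg h (u + v))%MM.
have E (w b c : 'X_{1..m}) (p : {mpoly K[m]}) :
    (w + (b + c))%MM = (hdeg h u + hdeg h v + hdeg h (u + v))%MM ->
    zcoeff z ('X_[b] * 'X_[c] * p) = zcoeff (a + mnmz w) p.
  by move=> wE; rewrite /z -wE mnmzD addrA -mpolyXD mulrC zcoeffMX.
have := congr1 (zcoeff z) (dual_dbinomD uL vL); rewrite raddfD /=.
rewrite (E (hdeg h u)) 1?(E (hdeg h v)) 1?(E (hdeg h (u + v))).
- by move/esym.
- by rewrite addmC.
- by rewrite addmA (addmC (hdeg h v)).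
- by rewrite addmA.
Qed.

Lemma dual_coeff_supp a v : dual_coeff a v != 0 -> in_semigroup h (a + mnmz (hdeg h v)).
Proof.
move=> /zcoeff_neq0[b bp ->].
by have /toric_predP := valP (submodule_val phi (insubd 0 (dbinom K h v))); apply.
Qed.

End Homogeneous.

Variable g : 'I_n -> 'rV[int]_n.
Hypothesis gL : forall i, g i \in L.
Hypothesis gE : forall v, v \in L -> v = \sum_i v 0 i *: g i.
Hypothesis extends : forall (a : 'rV[int]_m) (lam : 'rV[int]_n -> K),
  additive_on L lam ->
  (forall v, v \in L -> lam v != 0 -> in_semigroup h (a + mnmz (hdeg h v))) ->
  exists c : 'I_n -> K,
    (forall i, c i != 0 -> in_semigroup h (a + hvec h i)) /\
    (forall v, v \in L -> lam v = \sum_i c i *~ v 0 i).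

(** The coefficients c_{a,i} chosen in each degree a are assembled into r_i, the sum of c_{a,i}
    t^{a+h_i}, and dx_i is sent to r_i. The sum is finite because the vectors [g i] control all
    degrees in which [phi] is nonzero. *)
Lemma restr_surjective (phi : dual (U_R K h)) :
  exists f : dual 'rV[R]_n, phi = restr (@U_R_pred K m n h) f.
Proof.
have H a : exists c : 'I_n -> K,
    (forall i, c i != 0 -> in_semigroup h (a + hvec h i)) /\
    (forall v, v \in L -> dual_coeff phi a v = \sum_i c i *~ v 0 i).
  apply: extends; first exact: dual_coeff_additive.
  by move=> v _; apply: dual_coeff_supp.
have [c cP] := choice H.
(* The finitely many degrees a in which some [phi] (df_{g i}) has a nonzero coefficient; outside [A]
   additivity makes the coefficient vanish on all of L. *)
pose A := undup (flatten
  [seq [seq mnmz b - mnmz (hdeg h (g i)) | b <- msupp (dual_dbinom phi (g i))]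
     | i <- enum 'I_n]).
have AP a v : v \in L -> a \notin A -> dual_coeff phi a v = 0.
  move=> vL aA; rewrite (gE vL) (additive_on_sum (dual_coeff_additive phi a)) //.
  apply: big1 => i _; rewrite [dual_coeff _ _ _](_ : _ = 0) ?mul0rz //.
  apply: contraNeq aA => /zcoeff_neq0[b bp aE].
  rewrite mem_undup; apply/flatten_mapP; exists i; first by rewrite mem_enum.
  by apply/mapP; exists b => //; rewrite -aE addrK.
(* A total version of t^z; the absolute values are harmless because a nonzero c_{a,i} forces a + h_i
   into the semigroup. *)
pose X (z : 'rV[int]_m) : {mpoly K[m]} := 'X_[[multinom absz (z 0%R j) | j < m]].
have XP z : in_semigroup h z -> exists2 b, z = mnmz b & X z = 'X_[b].
  move=> [u]; rewrite -mnmz_sum => zE; eexists; first exact: zE.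
  by congr 'X_[_]; apply/mnmP => j; rewrite mnmE zE mxE.
pose r i := \sum_(a <- A) c a i *: X (a + hvec h i).
have rH i : r i \in toric_pred h.
  apply: rpred_sum => a _; have [->|ca] := eqVneq (c a i) 0.
    by rewrite scale0r rpred0.
  have zH := (cP a).1 i ca; apply: toric_predZ; have [b zE ->] := XP _ zH.
  by apply: toric_predX; rewrite -zE.
have rE i a : zcoeff (a + hvec h i) (r i) = if a \in A then c a i else 0.
  have E a' : zcoeff (a + hvec h i) (c a' i *: X (a' + hvec h i)) =
              if a' == a then c a i else 0.
    have [c0|ca] := eqVneq (c a' i) 0.
      by rewrite c0 scale0r raddf0; case: eqP => // <-.
    have [b zE ->] := XP _ ((cP a').1 i ca).
    rewrite linearZ_LR /= zcoeffX -zE (inj_eq (addIr _)).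
    by case: eqP => [->|_]; rewrite ?mulr1 ?mulr0.
  rewrite raddf_sum /= (eq_bigr _ (fun a' _ => E a')) -big_mkcond /=.
  case: ifPn => aA; last first.
    by rewrite big_seq_cond big1 // => a' /andP[+ /eqP aE]; rewrite aE (negPf aA).
  by rewrite -big_filter filter_pred1_uniq ?undup_uniq // big_seq1.
pose f := row_form (fun i => insubd (0 : R) (r i)).
exists f; apply: (@dual_ext _ _ _ _ _ _ _ (fun x => id)).
- by move=> _ [v vL ->]; apply: dbinom_U_R.
move=> _ [v vL ->]; apply: val_inj.
rewrite restrE insubdK; last exact: dbinom_U_R.
apply: zcoeffP => z; rewrite -/(dual_dbinom phi v).
have valf u : \val (submodule_val f u : R) = \sum_i \val (u 0 i) * r i.
  rewrite raddf_sum; apply: eq_bigr => i _; rewrite -{2}(insubdK (0 : R) (rH i)).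
  by [].
pose a := z - mnmz (hdeg h v).
have zE : z = a + mnmz (hdeg h v) by rewrite subrK.
rewrite [in LHS]zE -/(dual_coeff phi a v) valf raddf_sum /=.
have -> : dual_coeff phi a v = \sum_i (if a \in A then c a i else 0) *~ v 0 i.
  case: (boolP (a \in A)) => aA; first by rewrite (cP a).2.
  by rewrite (AP _ _ vL aA) big1 // => i _; rewrite mul0rz.
apply: eq_bigr => i _; rewrite -rE; have [le_h ->] := val_dbinom K i vL.
have [->|vi] := eqVneq (v 0 i) 0; first by rewrite !mulr0z mul0r raddf0.
rewrite mulrzAl (raddfMz (zcoeff z)) mulrC zE.
have -> : a + mnmz (hdeg h v) = a + hvec h i + mnmz (hdeg h v - h i)%MM.
  by rewrite -[RHS]addrA -mnmz_U -mnmzD addmC submK ?le_h.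
by congr (_ *~ _); rewrite -[LHS](zcoeffMX _ (hdeg h v - h i)%MM).
Qed.

Lemma toric_rigidP : toric_rigid K h.
Proof. exact/coker_eq0P/restr_surjective. Qed.

End Rigidity.

(** * Separations of relation lattices *)

Section MonomialFunctional.
Local Open Scope ring_scope.
Variables (K : fieldType) (n : nat) (chi : 'X_{1..n} -> K).

Definition mlinext (p : {mpoly K[n]}) : K := \sum_(u <- msupp p) p@_u * chi u.

Lemma mlinext_sub (r : seq 'X_{1..n}) p : uniq r -> {subset msupp p <= r} ->
  mlinext p = \sum_(u <- r) p@_u * chi u.
Proof.
move=> ur pr; rewrite [RHS](bigID (mem (msupp p))) /= [X in _ + X]big1 ?addr0.
  rewrite -big_filter; apply: perm_big; apply: uniq_perm => [||u].
  - exact: msupp_uniq.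
  - exact: filter_uniq.
  by rewrite mem_filter; case: (boolP (u \in msupp p)) => // /pr ->.
by move=> u up; rewrite (memN_msupp_eq0 up) mul0r.
Qed.

Lemma mlinext_is_linear : linear_for *%R mlinext.
Proof.
move=> a p q; pose r := undup (msupp p ++ msupp q ++ msupp (a *: p + q)).
have sub : [/\ {subset msupp p <= r}, {subset msupp q <= r} &
    {subset msupp (a *: p + q) <= r}].
  by split=> u; rewrite mem_undup !mem_cat => ->; rewrite ?orbT.
have [sp sq sr] := sub.
rewrite !(@mlinext_sub r) ?undup_uniq // mulr_sumr -big_split.
by apply: eq_bigr => u _; rewrite mcoeffD mcoeffZ mulrDl mulrA.
Qed.

HB.instance Definition _ :=
  GRing.isLinear.Build K {mpoly K[n]} K *%R mlinext mlinext_is_linear.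

Lemma mlinextX u : mlinext 'X_[u] = chi u.
Proof. by rewrite /mlinext msuppX big_seq1 mcoeffX eqxx mul1r. Qed.

End MonomialFunctional.

Section Substitution.
Local Open Scope ring_scope.
Variables (K : fieldType) (n n' : nat) (s : 'I_n' -> 'I_n).

(** The exponent of the image of x^u under the substitution of x_{s j} for x_j; [push_mx] is the
    corresponding matrix on integer vectors. *)
Definition mnm_push (u : 'X_{1..n'}) : 'X_{1..n} := (\sum_j U_(s j) *+ u j)%MM.
Definition push_mx : 'M[int]_(n', n) := \matrix_(j, k) (s j == k)%:Z.

Lemma mnmz_push u : mnmz (mnm_push u) = mnmz u *m push_mx.
Proof.
apply/rowP => k; rewrite !mxE mnm_sumE (big_morph Posz PoszD (erefl _)).
by apply: eq_bigr => j _; rewrite !mxE mulmnE mnm1E PoszM mulrC.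
Qed.

Lemma comp_mpoly_push (u : 'X_{1..n'}) :
  'X_[K, u] \mPo [tuple 'X_(s j) | j < n'] = 'X_[mnm_push u].
Proof.
rewrite comp_mpolyX (big_morph _ (@mpolyXD _ _) (@mpolyX0 _ _)).
by apply: eq_bigr => j _; rewrite tnth_mktuple mpolyXn.
Qed.

Definition posm k (v : 'rV[int]_k) : 'X_{1..k} :=
  [multinom (if (0 <= v 0 j)%R then absz (v 0%R j) else 0%N) | j < k].

Lemma mnmz_posmB k (v : 'rV[int]_k) : mnmz (posm v) - mnmz (posm (- v)) = v.
Proof.
apply/rowP => j; rewrite !mxE !mnmE !mxE.
case: (v 0 j) => [[|a]|a] //=; [exact: subr0 | exact: sub0r].
Qed.

Lemma binomE k (v : 'rV[int]_k) : binom K v = 'X_[posm v] - 'X_[posm (- v)].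
Proof.
rewrite /binom !mpolyXE_id; congr (_ - _); rewrite big_mkcond.
  by apply: eq_bigr => j _; rewrite mnmE; case: ifP.
by apply: eq_bigr => j _; rewrite mnmE mxE oppr_ge0 abszN; case: ifP.
Qed.

Lemma push_posmN u w :
  mnmz (mnm_push (u + posm (- w))%MM) =
  mnmz (mnm_push (u + posm w)%MM) - w *m push_mx.
Proof.
have E : mnmz (posm (- w)) = mnmz (posm w) - w.
  by rewrite -{3}(mnmz_posmB w) subKr.
by rewrite !mnmz_push !mnmzD E addrA mulmxBl.
Qed.

Variable L' : zmodClosed 'rV[int]_n'.

(** The ideal is spanned linearly by monomial multiples of binomials, and the substitution turns
    each of these into a difference of two monomials on which [chi] agrees. *)
Lemma lattice_ideal_linext (chi : 'X_{1..n} -> K) g :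
    (forall u w, w \in L' -> chi (mnm_push (u + posm w)%MM) =
                             chi (mnm_push (u + posm (- w))%MM)) ->
    g \in lattice_ideal K L' ->
  mlinext chi (g \mPo [tuple 'X_(s j) | j < n']) = 0.
Proof.
move=> chiL /asboolP[r [rA ->]].
rewrite (raddf_sum (comp_mpoly _)) (raddf_sum (mlinext chi)).
rewrite big_seq big1 //= => -[p f] /rA.
case=> w wL /= ->; rewrite /GRing.scale /= [p]mpolyE mulr_suml.
rewrite (raddf_sum (comp_mpoly _)) (raddf_sum (mlinext chi)) big1 //= => u _.
rewrite binomE -scalerAl mulrBr -!mpolyXD comp_mpolyZ linearZ_LR /= !raddfB /=.
by rewrite !comp_mpoly_push !mlinextX chiL // subrr mulr0.
Qed.

(** The last hypothesis concerns only those w whose shifted monomial is congruent to b modulo M.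
    This lets M record not just that a vector lifts to L', but also properties of the lift such as
    vanishing coordinates. *)
Lemma binomial_in_lattice (M : 'rV[int]_n -> Prop) (b c : 'X_{1..n}) g :
    M 0 -> (forall v w, M v -> M w -> M (v - w)) ->
    g \in lattice_ideal K L' ->
    'X_[b] - 'X_[c] = g \mPo [tuple 'X_(s j) | j < n'] ->
    (forall u w, w \in L' -> M (mnmz (mnm_push (u + posm w)%MM) - mnmz b) ->
       M (w *m push_mx)) ->
  M (mnmz b - mnmz c).
Proof.
move=> M0 MB gL gE MP.
have MN v : M v -> M (- v) by move=> Mv; rewrite -sub0r; apply: MB.
(* The indicator of the class of b modulo M takes equal values on the two
   monomials of every monomial multiple of a binomial of L'. *)
pose chi (u : 'X_{1..n}) : K := (`[< M (mnmz u - mnmz b) >])%:R.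
have imp u w : w \in L' -> M (mnmz (mnm_push (u + posm w)%MM) - mnmz b) ->
    M (mnmz (mnm_push (u + posm (- w))%MM) - mnmz b).
  move=> wL Mw; rewrite push_posmN addrAC; exact: MB Mw (MP _ _ wL Mw).
have chiE u w : w \in L' -> chi (mnm_push (u + posm w)%MM) =
                            chi (mnm_push (u + posm (- w))%MM).
  move=> wL; rewrite /chi; congr ((_ : bool)%:R).
  apply: asbool_equiv_eq; split=> [|Mw]; first exact: imp.
  by rewrite -[w]opprK; apply: imp; rewrite ?rpredN.
have := lattice_ideal_linext chiE gL; rewrite -gE raddfB /= !mlinextX => /eqP.
rewrite subr_eq0 /chi subrr (asboolT M0).
case: (asboolP (M _)) => [/MN|_]; first by rewrite opprB.
by rewrite mulr0n mulr1n oner_eq0.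
Qed.

End Substitution.

Section LatticeRank.
Local Open Scope ring_scope.
Variables (n : nat) (L : zmodClosed 'rV[int]_n).

Lemma lattice_rank_ge r (B : 'M[int]_(r, n)) : (r <= n)%N ->
  (forall j, row j B \in L) -> rows_indep B -> (r <= lattice_rank L)%N.
Proof.
rewrite -ltnS => rn BL Bi; apply: (leq_bigmax_cond (Ordinal rn)).
by apply/asboolP; exists B.
Qed.

Lemma lattice_rank_basis : exists B : 'M[int]_(lattice_rank L, n),
  (forall j, row j B \in L) /\ rows_indep B.
Proof.
have P0 : `[< exists B : 'M[int]_(0, n), (forall j, row j B \in L) /\ rows_indep B >].
  by apply/asboolP; exists 0; split=> [[]//|u _]; apply: thinmx0.
have c0 : (0 < #|[pred r : 'I_n.+1 | `[< exists B : 'M[int]_(r, n),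
    (forall j, row j B \in L) /\ rows_indep B >] ]|)%N.
  by apply/card_gt0P; exists ord0.
have [r /asboolP rP E] := eq_bigmax_cond (fun r : 'I_n.+1 => r : nat) c0.
by rewrite /lattice_rank E.
Qed.

Lemma lattice_rank_le : (lattice_rank L <= n)%N.
Proof. by apply/bigmax_leqP => r _; rewrite -ltnS. Qed.

End LatticeRank.

(** * Lifting lattice vectors through a separation *)

Section Separable.
Local Open Scope ring_scope.
Variables (K : fieldType) (m n : nat) (h : 'I_n -> 'X_{1..m}).
Notation L := (rel_lattice h).
Variable i : 'I_n.

Definition merge_ord (j : 'I_n.+1) : 'I_n :=
  if unlift ord_max j is Some j' then j' else i.

Lemma mergeE : merge K i = [tuple 'X_(merge_ord j) | j < n.+1].
Proof.
by apply: eq_from_tnth => j; rewrite !tnth_mktuple /merge_ord; case: unlift.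
Qed.

Notation S := (push_mx merge_ord).

Variable L' : zmodClosed 'rV[int]_n.+1.
Hypothesis rankL' : lattice_rank L' = lattice_rank L.
Hypothesis idealL' : forall f, f \in lattice_ideal K L <->
  exists2 f', f' \in lattice_ideal K L' & f = f' \mPo merge K i.

Lemma binom_in_lattice_ideal k (L0 : zmodClosed 'rV[int]_k) w :
  w \in L0 -> binom K w \in lattice_ideal K L0.
Proof.
move=> wL; apply/asboolP; exists [:: (1, binom K w)].
split=> [x|]; last by rewrite big_seq1 scale1r.
by rewrite inE => /eqP -> /=; exists w.
Qed.

(** The image of f_w lies in I_L and is a difference of two monomials whose exponents differ by w S;
    the binomial criterion is applied to L itself with the identity substitution. *)
Lemma push_in_lattice w : w \in L' -> w *m S \in L.
Proof.
move=> wL.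
have /idealL' : exists2 f', f' \in lattice_ideal K L' &
    binom K w \mPo merge K i = f' \mPo merge K i.
  by exists (binom K w) => //; apply: binom_in_lattice_ideal.
rewrite mergeE binomE raddfB /= !comp_mpoly_push => gL.
pose sid := @id 'I_n.
have Sid : push_mx sid = 1%:M by apply/matrixP => j k; rewrite !mxE; case: (_ == _).
rewrite -[w in w *m S]mnmz_posmB mulmxBl -!mnmz_push.
apply: (@binomial_in_lattice K n n sid L (fun v => v \in L) _ _ _ _ _ gL).
- exact: rpred0.
- by move=> u v; apply: rpredB.
- by rewrite comp_mpoly_id.
by move=> u v vL _; rewrite Sid mulmx1.
Qed.

Lemma rel_lattice_deg (p q : 'X_{1..n}) x : mnmz p - mnmz q \in L ->
  (\sum_k p k * h k x = \sum_k q k * h k x)%N.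
Proof.
move=> /eqP/rowP/(_ x); rewrite summxE mxE => E; apply/eqP.
rewrite -eqz_nat !(big_morph Posz PoszD (erefl _)) -subr_eq0 -sumrB -{2}E.
by apply/eqP/eq_bigr => k _; rewrite !mxE mulrBl !PoszM.
Qed.

(** Monomials congruent modulo L to the positive part of v all have t_x-degree 0, while x_i has
    positive t_x-degree. So none of them involves x_i, and the binomials of L' mapping into this
    class avoid both variables above x_i. *)
Lemma lift_avoiding v x : v \in L -> (0 < h i x)%N -> hdeg h v x = 0%N ->
  exists2 w, w \in L' & [/\ w *m S = v, w 0 (lift ord_max i) = 0 & w 0 ord_max = 0].
Proof.
move=> vL hix hvx; have /idealL'[f fL fE] := binom_in_lattice_ideal vL.
move: fE; rewrite mergeE binomE => fE.
pose M v := exists2 w, w \in L' &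
  [/\ w *m S = v, w 0 (lift ord_max i) = 0 & w 0 ord_max = 0].
have ML z : M z -> z \in L by move=> [w wL [<- _ _]]; apply: push_in_lattice.
have nonpos u w j : mnmz (mnm_push merge_ord (u + posm w)%MM) - mnmz (posm v) \in L ->
    merge_ord j = i -> w 0 j <= 0.
  move=> /(@rel_lattice_deg _ _ x) E ji; have : (\sum_k posm v k * h k x = 0)%N.
    rewrite -[RHS]hvx hdegE mnm_sumE; apply: eq_bigr => k _.
    by rewrite mulmnE mnmE mulnC.
  rewrite -E => /eqP; rewrite sum_nat_eq0 => /forallP/(_ i)/=.
  rewrite muln_eq0 (gtn_eqF hix) orbF mnm_sumE sum_nat_eq0 => /forallP/(_ j)/=.
  rewrite mulmnE mnm1E ji eqxx mul1n mnmDE addn_eq0 => /andP[_].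
  by rewrite mnmE leNgt; case: ifP => [/[swap]|]; case: (w 0 j) => [[]|].
change (M v); rewrite -[v]mnmz_posmB.
apply: (binomial_in_lattice _ _ fL fE).
- by exists 0; rewrite ?rpred0 ?mul0mx ?mxE.
- move=> _ _ [w1 w1L [<- a1 b1]] [w2 w2L [<- a2 b2]]; exists (w1 - w2).
    by rewrite rpredB.
  by rewrite mulmxBl !mxE a1 b1 a2 b2.
move=> u w wL /ML wM; exists w => //.
have mi : merge_ord (lift ord_max i) = i by rewrite /merge_ord liftK.
have mM : merge_ord ord_max = i by rewrite /merge_ord unlift_none.
(* The monomial attached to -w lies in the same class, so the bound holds for -w as well and both
   coordinates vanish. *)
have wM' : mnmz (mnm_push merge_ord (u + posm (- w))%MM) - mnmz (posm v) \in L.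
  have -> : mnmz (mnm_push merge_ord (u + posm (- w))%MM) - mnmz (posm v) =
      mnmz (mnm_push merge_ord (u + posm w)%MM) - mnmz (posm v) - w *m S.
    by rewrite push_posmN addrAC.
  by rewrite rpredB // push_in_lattice.
have z j : merge_ord j = i -> w 0 j = 0.
  move=> ji; apply/eqP; rewrite eq_le (nonpos _ _ _ wM ji).
  by have := nonpos _ _ _ wM' ji; rewrite mxE oppr_le0.
by rewrite !z.
Qed.

Lemma lattice_lift v : v \in L -> exists2 w, w \in L' & w *m S = v.
Proof.
move=> vL; have /idealL'[f fL fE] := binom_in_lattice_ideal vL.
move: fE; rewrite mergeE binomE => fE; pose M v := exists2 w, w \in L' & w *m S = v.
change (M v); rewrite -[v]mnmz_posmB.
apply: (binomial_in_lattice _ _ fL fE).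
- by exists 0; rewrite ?rpred0 ?mul0mx.
- by move=> _ _ [w1 w1L <-] [w2 w2L <-]; exists (w1 - w2); rewrite ?rpredB ?mulmxBl.
- by move=> u w wL _; exists w.
Qed.

(** A nonzero kernel vector appended to lifts of a maximal independent family of L would give rank L
    + 1 independent vectors in L', against the equality of ranks. *)
Lemma push_injective w : w \in L' -> w *m S = 0 -> w = 0.
Proof.
move=> wL wS; apply/eqP; apply: contraT => w0.
have [B [BL Bi]] := lattice_rank_basis L.
have lift_row j : exists u, u \in L' /\ u *m S = row j B.
  by have [u] := lattice_lift (BL j); exists u.
have [W WP] := choice lift_row.
pose C := col_mx (\matrix_j W j) w.
have CL j : row j C \in L'.
  case: (split_ordP j) => l ->; first by rewrite rowKu rowK; case: (WP l).
  by rewrite rowKd (_ : row l w = w) //; apply/rowP => k; rewrite mxE ord1.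
have Ci : rows_indep C.
  move=> u; rewrite -[u]hsubmxK mul_row_col => E.
  have WS : (\matrix_j W j) *m S = B.
    by apply/row_matrixP => j; rewrite row_mul rowK (WP j).2.
  have a0 : lsubmx u = 0.
    apply: Bi; have := congr1 (mulmx ^~ S) E.
    by rewrite mulmxDl -!mulmxA WS wS mulmx0 addr0 mul0mx.
  move: E; rewrite a0 mul0mx add0r [rsubmx u]mx11_scalar mul_scalar_mx.
  have /rV0Pn[k wk] := w0; move=> /rowP/(_ k)/eqP.
  by rewrite !mxE mulf_eq0 (negPf wk) orbF => /eqP ->; rewrite raddf0 row_mx0.
have := @lattice_rank_ge _ L' _ C _ CL Ci.
by rewrite rankL' addn1 ltnn ltnS lattice_rank_le => /(_ isT).
Qed.

End Separable.

Section Inseparable.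
Local Open Scope ring_scope.
Variables (K : fieldType) (m n : nat) (h : 'I_n -> 'X_{1..m}).
Notation L := (rel_lattice h).

(** Every g_j with j distinct from i lifts to a vector vanishing at both coordinates above i. Hence
    on these two coordinates each w_l is a multiple of the lift of g_i, and the two rows of
    condition (iii) are proportional. *)
Lemma inseparable_at (i : 'I_n) (g : 'I_n -> 'rV[int]_n) :
    (forall j, g j \in L) -> (forall v, v \in L -> v = \sum_j v 0 j *: g j) ->
    (forall j, j != i -> exists x, (0 < h i x)%N /\ hdeg h (g j) x = 0%N) ->
  ~ separable K L i.
Proof.
move=> gL gE gi [L' [_ rankL' idealL' [s [w [wL _ wi]]]]].
pose S := push_mx (merge_ord i).
have lift_g j : exists u : 'rV[int]_n.+1, [/\ u \in L', u *m S = g j &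
    j != i -> u 0 (lift ord_max i) = 0 /\ u 0 ord_max = 0].
  case: (eqVneq j i) => [_|ji].
    by have [u] := lattice_lift idealL' (gL j); exists u.
  have [x [hx gx]] := gi j ji.
  by have [u uL [uS ui um]] := lift_avoiding idealL' (gL j) hx gx; exists u.
have [W WP] := choice lift_g.
(* Both sides have the same image in L, and merging is injective on L'. *)
have wE l : w l = \sum_j (w l *m S) 0 j *: W j.
  apply/eqP; rewrite -subr_eq0; apply/eqP.
  have ZL (x : int) u : u \in L' -> x *: u \in L'.
    by move=> uL; rewrite -[x]intz scaler_int rpredMz.
  apply: (push_injective rankL' idealL').
    by rewrite rpredB ?rpred_sum // => j _; apply: ZL; case: (WP j).
  have /gE E := push_in_lattice idealL' (wL l).
  rewrite mulmxBl mulmx_suml {1}E -sumrB big1 // => j _.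
  by case: (WP j) => _ WS _; rewrite -scalemxAl WS subrr.
pose x l := (w l *m S) 0 i.
have ZE (a : int) (u : 'rV[int]_n.+1) k : (a *: u) 0 k = a * u 0 k.
  by rewrite mxE.
have coord l k : k = ord_max \/ k = lift ord_max i -> w l 0 k = x l * W i 0 k.
  move=> kE; rewrite [w l]wE summxE (bigD1 i) //= big1 ?addr0 => [|j ji].
    by rewrite ZE.
  rewrite ZE; case: (WP j) => _ _ /(_ ji)[a b].
  by case: kE => ->; rewrite ?a ?b mulr0.
pose al := W i 0 (lift ord_max i); pose be := W i 0 ord_max.
(* The proportionality relation forces [al] = [be] = 0. Then the row of last coordinates is itself
   zero, which again contradicts independence. *)
have E1 : row_mx al%:M (- be)%:M = 0 :> 'rV[int]_(1 + 1).
  apply: wi; rewrite mul_row_col !mul_scalar_mx; apply/rowP => l.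
  rewrite !mxE !coord; [|by right|by left].
  by rewrite mulNr mulrCA [be * _]mulrCA [al * be]mulrC subrr.
have {E1} [al0 be0] : al = 0 /\ be = 0.
  move/rowP: E1 => E1; split.
    by have := E1 (lshift 1 ord0); rewrite row_mxEl !mxE mulr1n.
  have /eqP := E1 (rshift 1 ord0).
  by rewrite row_mxEr !mxE mulr1n oppr_eq0 => /eqP.
have /rowP/(_ (lshift 1 ord0)) : row_mx 1%:M 0 = 0 :> 'rV[int]_(1 + 1).
  apply: wi; rewrite mul_row_col mul0mx addr0 mul1mx; apply/rowP => l.
  by rewrite !mxE coord; [rewrite -/be be0 mulr0 | left].
by rewrite row_mxEl !mxE.
Qed.

End Inseparable.

(** * The complete bipartite graph minus an edge *)

Section Bipartite.
Local Open Scope ring_scope.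
Variables (m n k : nat) (r c : 'I_n -> 'I_m) (v0 v1 : 'I_m).

Definition is_edge (i j : 'I_m) :=
  [&& (i < k)%N, (k <= j)%N & ~~ ((i == v0) && (j == v1))].

Hypotheses (v0k : (v0 < k)%N) (kv1 : (k <= v1)%N).
Hypothesis rcP : forall e, is_edge (r e) (c e).
Hypothesis rc_inj : forall e f, r e = r f -> c e = c f -> e = f.
Hypothesis rc_surj : forall i j, is_edge i j -> exists e, r e = i /\ c e = j.

Definition edge_mon (e : 'I_n) : 'X_{1..m} := (U_(r e) + U_(c e))%MM.
Notation h := edge_mon.
Notation L := (rel_lattice h).

(** * Four-cycles and the relation lattice *)

Lemma rk e : (r e < k)%N. Proof. by case/and3P: (rcP e). Qed.
Lemma ck e : (k <= c e)%N. Proof. by case/and3P: (rcP e). Qed.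

Lemma row_neq_col (i j : 'I_m) : (i < k)%N -> (k <= j)%N -> (i == j) = false.
Proof. by move=> ik kj; apply/eqP => E; rewrite E ltnNge kj in ik. Qed.

(** This is 0 when {i, j} is not an edge, so [cyc] makes sense for all indices; its membership in
    the lattice is asserted only when all four corners are edges. *)
Definition edge_vec (i j : 'I_m) : 'rV[int]_n :=
  \row_e ((r e == i) && (c e == j))%:Z.

Definition cyc (i i' j j' : 'I_m) : 'rV[int]_n :=
  edge_vec i j - edge_vec i' j - edge_vec i j' + edge_vec i' j'.

Lemma edge_vecE e : edge_vec (r e) (c e) = delta_mx 0 e.
Proof.
apply/rowP => f; rewrite !mxE eqxx /= natz; congr (Posz (nat_of_bool _)).
by apply/andP/eqP => [[/eqP rE /eqP cE]|->//]; apply: rc_inj.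
Qed.

Lemma hvec_edge e : hvec h e = delta_mx 0 (r e) + delta_mx 0 (c e).
Proof.
apply/rowP => x; rewrite !mxE /= mnmDE !mnm1E PoszD ![x == _]eq_sym.
by case: (r e == x); case: (c e == x).
Qed.

Definition edge_deg (v : 'rV[int]_n) : 'rV[int]_m := \sum_e v 0 e *: hvec h e.

Lemma edge_degD u v : edge_deg (u + v) = edge_deg u + edge_deg v.
Proof.
by rewrite -big_split; apply: eq_bigr => e _; rewrite mxE scalerDl.
Qed.

Lemma edge_degN u : edge_deg (- u) = - edge_deg u.
Proof. by rewrite -sumrN; apply: eq_bigr => e _; rewrite mxE scaleNr. Qed.

Lemma edge_deg_vec i j : is_edge i j ->
  edge_deg (edge_vec i j) = delta_mx 0 i + delta_mx 0 j.
Proof.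
move=> /rc_surj[e [<- <-]]; rewrite edge_vecE /edge_deg (bigD1 e) //= big1 => [|f fe].
  by rewrite addr0 !mxE !eqxx scale1r hvec_edge.
by rewrite mxE (negPf fe) andbF scale0r.
Qed.

Lemma cyc_in i i' j j' : is_edge i j -> is_edge i' j -> is_edge i j' ->
  is_edge i' j' -> cyc i i' j j' \in L.
Proof.
move=> ij i'j ij' i'j'; apply/eqP; rewrite -/(edge_deg _).
rewrite !edge_degD !edge_degN !edge_deg_vec //.
by rewrite !opprD; apply/rowP => x; rewrite !mxE; lia.
Qed.

Lemma cyc_trans i i' i'' j j' : cyc i i' j j' + cyc i' i'' j j' = cyc i i'' j j'.
Proof. by apply/rowP => e; rewrite !mxE; lia. Qed.

Lemma lattice_row v x : v \in L -> \sum_(e | r e == x) v 0 e = 0.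
Proof.
move=> /eqP/rowP/(_ x); rewrite summxE mxE => E.
have [xk|kx] := ltnP x k; last first.
  by rewrite big1 // => e /eqP rE; have := rk e; rewrite rE ltnNge kx.
rewrite -[RHS]E big_mkcond; apply: eq_bigr => e _.
rewrite mxE hvec_edge !mxE /= ![x == _]eq_sym [c e == x]eq_sym (row_neq_col xk (ck e)).
by case: (r e == x); rewrite ?addr0 ?mulr1 ?mulr0.
Qed.

Lemma lattice_col v x : v \in L -> \sum_(e | c e == x) v 0 e = 0.
Proof.
move=> /eqP/rowP/(_ x); rewrite summxE mxE => E.
have [xk|kx] := ltnP x k.
  by rewrite big1 // => e /eqP cE; have := ck e; rewrite cE leqNgt xk.
rewrite -[RHS]E big_mkcond; apply: eq_bigr => e _.
rewrite mxE hvec_edge !mxE /= ![x == _]eq_sym (row_neq_col (rk e) kx).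
by case: (c e == x); rewrite ?add0r ?mulr1 ?mulr0.
Qed.

(** Grouping by rows and by columns leaves the row and column sums of v, which vanish. Such
    potentials are the freedom available in choosing the c_e. *)
Lemma lattice_potential (V : zmodType) (al be : 'I_m -> V) v : v \in L ->
  \sum_e (al (r e) + be (c e)) *~ v 0 e = 0.
Proof.
move=> vL; under eq_bigr do rewrite mulrzDl; rewrite big_split /=.
rewrite (partition_big r xpredT) //= (partition_big c xpredT (P := xpredT)) //=.
rewrite !big1 ?addr0 // => x _.
  rewrite (eq_bigr (fun e => be x *~ v 0 e)) => [|e /eqP -> //].
  by rewrite -mulrz_sumr lattice_col ?mulr0z.
rewrite (eq_bigr (fun e => al x *~ v 0 e)) => [|e /eqP -> //].
by rewrite -mulrz_sumr lattice_row ?mulr0z.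
Qed.

(** Of the four terms of the cycles the first adds up to v; the other three collect column sums, row
    sums and the total sum of v, all zero. *)
Lemma lattice_decomp i j v : v \in L ->
  v = \sum_e v 0 e *: cyc (r e) i (c e) j.
Proof.
move=> vL; apply/rowP => f; rewrite summxE.
have S1 : \sum_e v 0 e = 0.
  have := lattice_potential (fun=> 1) (fun=> 0) vL.
  by move=> E; rewrite -[RHS]E; apply: eq_bigr => e _; rewrite addr0 intz.
rewrite (eq_bigr (fun e => v 0 e * (f == e)%:R -
    (r f == i)%:R * (v 0 e * (c e == c f)%:R) -
    (c f == j)%:R * (v 0 e * (r e == r f)%:R) +
    ((r f == i) && (c f == j))%:R * v 0 e)); last first.
  move=> e _; rewrite !mxE.
  have -> : (f == e) = (r f == r e) && (c f == c e).
    by apply/eqP/andP => [->|[/eqP rE /eqP cE]]; [rewrite !eqxx|apply: rc_inj].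
  rewrite [c e == _]eq_sym [r e == _]eq_sym.
  by case: (r f == i); case: (c f == j); case: (r f == r e);
    case: (c f == c e); rewrite /=; lia.
rewrite big_split !sumrB /= -!mulr_sumr S1 mulr0 addr0.
have -> : \sum_e v 0 e * (c e == c f)%:R = 0.
  rewrite -[RHS](lattice_col (c f) vL) [RHS]big_mkcond; apply: eq_bigr => e _.
  by case: eqP; rewrite ?mulr1 ?mulr0.
have -> : \sum_e v 0 e * (r e == r f)%:R = 0.
  rewrite -[RHS](lattice_row (r f) vL) [RHS]big_mkcond; apply: eq_bigr => e _.
  by case: eqP; rewrite ?mulr1 ?mulr0.
rewrite !mulr0 !subr0 (bigD1 f) //= big1 ?addr0 ?eqxx ?mulr1 // => e ef.
by rewrite eq_sym (negPf ef) mulr0.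
Qed.

Lemma cyc_rr i j j' : cyc i i j j' = 0.
Proof. by apply/rowP => e; rewrite !mxE; lia. Qed.

Lemma cyc_cc i i' j : cyc i i' j j = 0.
Proof. by apply/rowP => e; rewrite !mxE; lia. Qed.

Lemma hdeg_cyc i i' j j' : is_edge i j -> is_edge i' j' -> i != i' -> j != j' ->
  hdeg h (cyc i i' j j') = (U_(i) + U_(j) + (U_(i') + U_(j')))%MM.
Proof.
move=> /rc_surj[e1 [<- <-]] /rc_surj[e4 [<- <-]] r14 c14.
have eqE e f : (e == f) = (r e == r f) && (c e == c f).
  by apply/eqP/andP => [->|[/eqP rE /eqP cE]]; [rewrite !eqxx|apply: rc_inj].
rewrite -!/(h _) hdegE; apply/mnmP => x; rewrite mnm_sumE mnmDE.
rewrite (eq_bigr (fun e => h e x * (e == e1) + h e x * (e == e4)))%N.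
  rewrite big_split /=; congr addn.
    by rewrite (bigD1 e1) //= eqxx muln1 big1 ?addn0 // => e /negPf ->; rewrite muln0.
  by rewrite (bigD1 e4) //= eqxx muln1 big1 ?addn0 // => e /negPf ->; rewrite muln0.
move=> e _; rewrite mulmnE -mulnDr; congr muln; rewrite !mxE !eqE.
have := r14; have := c14.
case: (eqVneq (r e) (r e1)) => [->|_]; case: (eqVneq (c e) (c e1)) => [->|_].
all: by move=> /negPf c1 /negPf r1; rewrite ?c1 ?r1;
  case: (r e == r e4); case: (c e == c e4).
Qed.

(** * The semigroup as the lattice points of a cone *)

Definition rsum (z : 'rV[int]_m) : int := \sum_(x : 'I_m | (x < k)%N) z 0 x.
Definition csum (z : 'rV[int]_m) : int := \sum_(x : 'I_m | (k <= x)%N) z 0 x.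

Lemma rsumD y z : rsum (y + z) = rsum y + rsum z.
Proof. by rewrite -big_split; apply: eq_bigr => x _; rewrite mxE. Qed.

Lemma csumD y z : csum (y + z) = csum y + csum z.
Proof. by rewrite -big_split; apply: eq_bigr => x _; rewrite mxE. Qed.

Lemma sum_delta (A : pred 'I_m) x :
  \sum_(y | A y) (delta_mx 0 x : 'rV[int]_m) 0 y = (A x)%:Z.
Proof.
rewrite big_mkcond (bigD1 x) //= big1 => [|y yx].
  by rewrite mxE !eqxx addr0; case: (A x).
by rewrite mxE (negPf yx) andbF; case: (A y).
Qed.

Lemma rsum_hvec e : rsum (hvec h e) = 1.
Proof. by rewrite hvec_edge rsumD /rsum !sum_delta rk ltnNge ck. Qed.

Lemma csum_hvec e : csum (hvec h e) = 1.
Proof. by rewrite hvec_edge csumD /csum !sum_delta ck leqNgt rk. Qed.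

Lemma rsumB_hvec z e : rsum (z - hvec h e) = rsum z - 1.
Proof. by rewrite -[z in RHS](subrK (hvec h e)) [in RHS]rsumD rsum_hvec addrK. Qed.

Lemma csumB_hvec z e : csum (z - hvec h e) = csum z - 1.
Proof. by rewrite -[z in RHS](subrK (hvec h e)) [in RHS]csumD csum_hvec addrK. Qed.

Lemma entryD (y z : 'rV[int]_m) x : (y + z) 0 x = y 0 x + z 0 x.
Proof. by rewrite mxE. Qed.

Lemma entryB (y z : 'rV[int]_m) x : (y - z) 0 x = y 0 x - z 0 x.
Proof. by rewrite !mxE. Qed.

Lemma hvec_row e (x : 'I_m) : (x < k)%N -> hvec h e 0 x = (r e == x)%:Z.
Proof.
move=> xk; rewrite mxE mnmDE !mnm1E [c e == x]eq_sym (row_neq_col xk (ck e)).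
by rewrite addn0.
Qed.

Lemma hvec_col e (x : 'I_m) : (k <= x)%N -> hvec h e 0 x = (c e == x)%:Z.
Proof. by move=> kx; rewrite mxE mnmDE !mnm1E (row_neq_col (rk e) kx). Qed.

Definition edge_cone (z : 'rV[int]_m) : Prop :=
  [/\ forall x, 0 <= z 0 x, rsum z = csum z & z 0 v0 + z 0 v1 <= rsum z].

Lemma edge_coneD y z : edge_cone y -> edge_cone z -> edge_cone (y + z).
Proof.
move=> [y0 ys yl] [z0 zs zl]; split=> [x||]; rewrite ?rsumD ?csumD ?mxE.
- by rewrite addr_ge0.
- by rewrite ys zs.
- by rewrite addrACA lerD.
Qed.

Lemma edge_cone0 : edge_cone 0.
Proof.
split=> [x||]; first by rewrite mxE.
- by rewrite /rsum /csum !big1 // => x _; rewrite mxE.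
- by rewrite /rsum big1 => [|x _]; rewrite !mxE.
Qed.

Lemma edge_cone_hvec e : edge_cone (hvec h e).
Proof.
split=> [x||]; first by rewrite mxE.
  by rewrite rsum_hvec csum_hvec.
rewrite rsum_hvec hvec_row // hvec_col //.
by have /and3P[_ _] := rcP e; case: (r e == v0); case: (c e == v1).
Qed.

Lemma exists_pos (I : finType) (A : pred I) (F : I -> int) y : A y ->
  F y < \sum_(x | A x) F x -> exists x, [/\ A x, x != y & 0 < F x].
Proof.
move=> Ay; rewrite (bigD1 y) //=.
have [/existsP[x /and3P[? ? ?]]|/existsPn H] :=
  boolP [exists x, [&& A x, x != y & 0 < F x]]; first by exists x.
rewrite ltrDl ltNge => /negP[]; apply: sumr_le0 => x /andP[Ax xy].
by have := H x; rewrite Ax xy /= -leNgt.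
Qed.

(** If the inequality on z_{v0} + z_{v1} is strict, an edge avoiding v0 and v1 can be removed. If it
    is an equality, the removed edge must contain one of them: v0 when z_{v0} > 0, and v1
    otherwise. *)
Lemma edge_cone_step z : edge_cone z -> 0 < rsum z ->
  exists e, edge_cone (z - hvec h e).
Proof.
move=> [z0 zs zl] z1.
suff [i [j [ij zi zj ok]]] : exists i j, [/\ is_edge i j, 0 < z 0 i, 0 < z 0 j &
    z 0 v0 - (i == v0)%:Z + (z 0 v1 - (j == v1)%:Z) <= rsum z - 1].
  have [e [ri cj]] := rc_surj ij; exists e; rewrite -ri -cj in ij zi zj ok *.
  have rs := rsumB_hvec z e; have cs := csumB_hvec z e.
  split=> [x||]; last by rewrite rs !entryB hvec_row // hvec_col.
    rewrite entryB; have [xk|kx] := ltnP x k.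
      by rewrite hvec_row //; case: eqP => [<-|_]; [lia|rewrite subr0].
    by rewrite hvec_col //; case: eqP => [<-|_]; [lia|rewrite subr0].
  by rewrite rs cs zs.
have zv0 := z0 v0; have zv1 := z0 v1.
have [lpos|l0] := ltrP (z 0 v0 + z 0 v1) (rsum z).
  have [|i [ik i0 zi]] := @exists_pos _ (fun x : 'I_m => x < k)%N (z 0) v0 v0k.
    rewrite -/(rsum z); lia.
  have [|j [kj j1 zj]] := @exists_pos _ (fun x : 'I_m => k <= x)%N (z 0) v1 kv1.
    rewrite -/(csum z); lia.
  exists i, j; split=> //; first by rewrite /is_edge ik kj (negPf i0).
  rewrite (negPf i0) (negPf j1); lia.
have [zv0p|zv0n] := ltrP 0 (z 0 v0).
  have [|j [kj j1 zj]] := @exists_pos _ (fun x : 'I_m => k <= x)%N (z 0) v1 kv1.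
    rewrite -/(csum z); lia.
  exists v0, j; split=> //; first by rewrite /is_edge v0k kj (negPf j1) andbF.
  rewrite eqxx (negPf j1); lia.
have [|i [ik i0 zi]] := @exists_pos _ (fun x : 'I_m => x < k)%N (z 0) v0 v0k.
  rewrite -/(rsum z); lia.
exists i, v1; split=> //; first by rewrite /is_edge ik kv1 (negPf i0).
  lia.
rewrite eqxx (negPf i0); lia.
Qed.

(** Generators satisfy the inequalities; conversely edges are peeled off by induction on [rsum z],
    and [rsum z] = 0 forces z = 0. *)
Lemma semigroupP z : in_semigroup h z <-> edge_cone z.
Proof.
split=> [[u ->]|].
  elim/big_ind: _ => [||e _]; [exact: edge_cone0|exact: edge_coneD|].
  elim: (u e) => [|N IH]; first by rewrite scale0r; apply: edge_cone0.
  rewrite -[N.+1]addn1 PoszD scalerDl scale1r; apply: edge_coneD IH _.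
  exact: edge_cone_hvec.
have [N] := ubnP (absz (rsum z)); elim: N z => // N IH z zN zC.
have rs0 : 0 <= rsum z by apply: sumr_ge0 => x _; case: zC.
have [rsp|rsn] := ltrP 0 (rsum z); last first.
  have [z0 zs _] := zC; have r0 : rsum z = 0 by lia.
  exists (fun=> 0%N); rewrite big1 => [|e _]; last by rewrite scale0r.
  apply/rowP => x; rewrite mxE.
  have [xk|kx] := ltnP x k.
    by have /psumr_eq0P -> := r0.
  rewrite zs in r0.
  by have /psumr_eq0P -> := r0.
have [e eC] := edge_cone_step zC rsp.
have rs := rsumB_hvec z e.
have [|u uE] := IH _ _ eC; first by rewrite rs; lia.
exists (fun f => u f + (f == e))%N.
rewrite -[LHS](subrK (hvec h e)) uE; under [RHS]eq_bigr do rewrite PoszD scalerDl.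
rewrite big_split /=; congr (_ + _).
rewrite (bigD1 e) //= eqxx scale1r big1 ?addr0 // => f /negPf ->.
by rewrite scale0r.
Qed.

Lemma is_edge_row (i j : 'I_m) : (i < k)%N -> i != v0 -> (k <= j)%N -> is_edge i j.
Proof. by move=> ik i0 kj; rewrite /is_edge ik kj (negPf i0). Qed.

Lemma is_edge_col (i j : 'I_m) : (i < k)%N -> j != v1 -> (k <= j)%N -> is_edge i j.
Proof. by move=> ik j1 kj; rewrite /is_edge ik kj (negPf j1) andbF. Qed.

Lemma hdeg_split (v : 'rV[int]_n) e e' : 0 < v 0 e -> 0 < v 0 e' -> e != e' ->
  exists2 b, in_semigroup h (mnmz b) & hdeg h v = (h e + h e' + b)%MM.
Proof.
move=> ve ve' ee'.
pose p l := if (0 <= v 0 l)%R then absz (v 0%R l) else 0%N.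
(* The truncated subtractions are exact, since e and e' are distinct and both have positive
   multiplicity. *)
exists (\sum_l h l *+ (p l - (l == e) - (l == e')))%MM.
  by rewrite mnmz_sum; eexists.
rewrite hdegE; apply/mnmP => x; rewrite 2!mnmDE !mnm_sumE.
rewrite (eq_bigr (fun l => (h l x * (l == e) + h l x * (l == e')) +
                           h l x * (p l - (l == e) - (l == e'))))%N.
  rewrite !big_split /=; congr (_ + _ + _)%N.
  - by rewrite (bigD1 e) //= eqxx muln1 big1 ?addn0 // => l /negPf ->; rewrite muln0.
  - by rewrite (bigD1 e') //= eqxx muln1 big1 ?addn0 // => l /negPf ->; rewrite muln0.
  by apply: eq_bigr => l _; rewrite mulmnE.
move=> l _; rewrite mulmnE -!mulnDr -/(p l); congr muln.
have pp : 0 < v 0 l -> (0 < p l)%N.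
  by rewrite /p; case: (v 0 l) => [[]|].
case: (eqVneq l e) => [le|_]; case: (eqVneq l e') => [le'|_].
- by rewrite -le -le' eqxx in ee'.
- by rewrite le in pp *; have := pp ve; lia.
- by rewrite le' in pp *; have := pp ve'; lia.
- lia.
Qed.

(** * A nontrivial class when there are three rows *)

Section NotRigid.
Variables (K : fieldType) (i1 i2 : 'I_m).
Hypotheses (i1k : (i1 < k)%N) (i2k : (i2 < k)%N).
Hypotheses (i12 : i1 != i2) (i10 : i1 != v0) (i20 : i2 != v0).
Hypothesis rows : forall x : 'I_m, (x < k)%N -> [|| x == v0, x == i1 | x == i2].
Variable j : 'I_m.
Hypotheses (kj : (k <= j)%N) (j1 : j != v1).
Variables e1 : 'I_n.
Hypotheses (re1 : r e1 = i1) (ce1 : c e1 = v1).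

(** Column v1 meets only the rows i1 and i2, so v takes opposite values at its two edges. One of
    them is positive, and the zero sum of the other row yields a positive edge there; together they
    split off h_{e1} and t_{i2}. *)
Lemma twisted_degree (v : 'rV[int]_n) : v \in L -> v 0 e1 != 0 ->
  exists2 b, in_semigroup h (mnmz b) &
    (U_(i2) + b)%MM = (U_(v0) + (hdeg h v - h e1))%MM.
Proof.
move=> vL ve1.
have [e2 [re2 ce2]] := rc_surj (is_edge_row i2k i20 kv1).
have e12 : e1 != e2 by apply: contra i12 => /eqP E; rewrite -re1 -re2 E.
have col1 : v 0 e1 + v 0 e2 = 0.
  rewrite -[RHS](lattice_col v1 vL) (bigD1 e1) ?ce1 //= (bigD1 e2) /=; last first.
    by rewrite ce2 eqxx eq_sym.
  rewrite big1 ?addr0 // => e /andP[/andP[/eqP cE ee1] ee2].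
  have := rcP e; rewrite /is_edge cE eqxx andbT => /and3P[_ _ r0].
  have /or3P[/eqP rE|/eqP rE|/eqP rE] := rows (rk e).
  - by rewrite rE eqxx in r0.
  - by rewrite (@rc_inj e e1) ?eqxx ?cE ?rE in ee1.
  - by rewrite (@rc_inj e e2) ?eqxx ?cE ?rE in ee2.
(* The vertex i2 is traded for v0: the column of e' is not v1, so it forms an edge with v0. *)
have finish e e' : (h e + h e')%MM = (h e1 + (U_(i2) + U_(c e')))%MM ->
    c e' != v1 -> 0 < v 0 e -> 0 < v 0 e' -> e != e' ->
    exists2 b, in_semigroup h (mnmz b) &
      (U_(i2) + b)%MM = (U_(v0) + (hdeg h v - h e1))%MM.
  move=> hE cN ve ve' ee'; have [b bH ->] := hdeg_split ve ve' ee'.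
  have [f [rf cf]] := rc_surj (is_edge_col v0k cN (ck e')).
  exists (h f + b)%MM.
    rewrite mnmzD; apply/semigroupP/edge_coneD; last exact/semigroupP.
    exact: edge_cone_hvec.
  rewrite hE -addmA [(h e1 + _)%MM]addmC addmK /edge_mon rf cf.
  by apply/mnmP => x; rewrite !mnmDE; lia.
have [ve1p|ve1n] := ltrP 0 (v 0 e1).
  have ve2 : v 0 e2 < \sum_(e | r e == i2) v 0 e by rewrite lattice_row //; lia.
  have [|e [/eqP re ee2 ve]] := exists_pos _ ve2; first by rewrite re2.
  apply: (finish e1 e) => //.
  - by rewrite /edge_mon re.
  - by apply: contra ee2 => /eqP cE; apply/eqP/rc_inj; rewrite ?re ?re2 ?cE.
  - by apply: contra i12 => /eqP E; rewrite -re1 E re.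
have ve1' : v 0 e1 < \sum_(e | r e == i1) v 0 e.
  by rewrite lattice_row // lt_neqAle ve1.
have [|e [/eqP re ee1 ve]] := exists_pos _ ve1'; first by rewrite re1.
apply: (finish e2 e) => //.
- by rewrite /edge_mon re re1 re2 ce1 ce2; apply/mnmP => x; rewrite !mnmDE; lia.
- by apply: contra ee1 => /eqP cE; apply/eqP/rc_inj; rewrite ?re ?re1 ?cE.
- by move: ve1n; rewrite le_eqVlt (negPf ve1) /=; lia.
- by apply: contra i12 => /eqP E; rewrite -re -re2 E.
Qed.

(* The nontrivial class is u |-> (t_{v0} / t_{i2}) u_{e1}: on U_R this quotient
   lies in R. *)
Lemma twisted_hom_exists (u : U_R K h) : exists y : toric_ring K h,
  'X_i2 * \val y = 'X_v0 * \val (\val u 0 e1).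
Proof.
pose Q (w : 'rV[toric_ring K h]_n) := exists y : toric_ring K h,
  'X_i2 * \val y = 'X_v0 * \val (w 0 e1).
have QD a w w' : Q w -> Q w' -> Q (a *: w + w').
  move=> [y yE] [y' yE']; exists (a * y + y').
  have V1 : \val (a * y + y') = \val a * \val y + \val y' by [].
  have V2 : \val ((a *: w + w') 0 e1) = \val a * \val (w 0 e1) + \val (w' 0 e1).
    by rewrite !mxE.
  by rewrite V1 V2 !mulrDr !(mulrCA _ (\val a)) yE yE'.
have Q0 : Q 0 by exists 0; rewrite mxE !mulr0.
rewrite -/(Q (\val u)); have /asboolP[s [sA ->]] := valP u.
rewrite big_seq; elim/big_ind: _ => // [w w' Qw Qw'|x /sA[v vL ->]].
  by rewrite -[w]scale1r; apply: QD.
rewrite -[_ *: _]addr0; apply: QD Q0.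
have [_ vE] := val_dbinom K e1 vL.
have [vz|ve1] := eqVneq (v 0 e1) 0.
  by exists 0; rewrite vE vz mulr0z !mulr0.
have [b bH bE] := twisted_degree vL ve1.
have bT : ('X_[b] *~ v 0 e1 : {mpoly K[m]}) \in toric_pred h.
  by apply/rpredMz/toric_predX.
exists (insubd 0 ('X_[b] *~ v 0 e1)); rewrite insubdK // vE !mulrzAr -!mpolyXD.
by rewrite bE.
Qed.

(** On the 4-cycle on i1, i2, v1, j the twisted map takes the value t_{v0} t_j. A map from the free
    module would give a combination of the entries of df_v, each divisible by t_{i1} or t_{i2}. *)
Lemma edge_not_rigid : ~ toric_rigid K h.
Proof.
move=> /coker_eq0P rig.
have [F FP] := choice twisted_hom_exists.
(* The chosen values are unique because t_{i2} can be cancelled, and this yields linearity. *)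
have Fl : linear (F : U_R K h -> (toric_ring K h)^o).
  move=> a x y; apply: val_inj; have X0 : 'X_i2 != 0 :> {mpoly K[m]}.
    by rewrite -msupp_eq0 msuppX.
  apply: (mulfI X0); rewrite FP.
  have V1 : \val (a * F x + F y) = \val a * \val (F x) + \val (F y) by [].
  rewrite -[RHS]/('X_i2 * \val (a * F x + F y)) V1 mulrDr mulrCA !FP.
  have V2 : \val (\val (a *: x + y) 0 e1) =
      \val a * \val (\val x 0 e1) + \val (\val y 0 e1) by rewrite !mxE.
  by rewrite V2 mulrDr mulrCA.
have [f fE] := rig (dual_of Fl).
have v1k := is_edge_row i1k i10 kv1; have v2k := is_edge_row i2k i20 kv1.
have jk1 := is_edge_row i1k i10 kj; have jk2 := is_edge_row i2k i20 kj.
pose v := cyc i1 i2 v1 j; have vL : v \in L by apply: cyc_in.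
have hv : hdeg h v = (U_(i1) + U_(v1) + (U_(i2) + U_(j)))%MM.
  by rewrite hdeg_cyc // eq_sym.
have ve1 : v 0 e1 = 1.
  by rewrite !mxE re1 ce1 !eqxx (negPf i12) [v1 == j]eq_sym (negPf j1).
pose D : U_R K h := insubd 0 (dbinom K h v).
have DE : \val D = dbinom K h v by rewrite insubdK //; apply: dbinom_U_R.
have FD : \val (F D) = 'X_v0 * 'X_j.
  have X0 : 'X_i2 != 0 :> {mpoly K[m]} by rewrite -msupp_eq0 msuppX.
  apply: (mulfI X0); rewrite FP DE; have [_ ->] := val_dbinom K e1 vL.
  rewrite ve1 mulr1z hv /edge_mon re1 ce1 addmC addmK mpolyXD.
  by rewrite mulrCA.
have FE : F D = \sum_e dbinom K h v 0 e *
    (submodule_val f (delta_mx 0 e) : toric_ring K h).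
  have := congr1 (fun g => submodule_val g D) fE.
  by rewrite /= -[submodule_val D]/(\val D) DE dual_rowE.
(* Evaluation at this point kills t_{i1} and t_{i2} but sends t_{v0} t_j to 1. *)
pose pt (x : 'I_m) : K := if (x == i1) || (x == i2) then 0 else 1.
have ptX (b : 'X_{1..m}) (x : 'I_m) : (x == i1) || (x == i2) ->
    (0 < b x)%N -> ('X_[b] : {mpoly K[m]}).@[pt] = 0.
  move=> xi bx; rewrite mevalX (bigD1 x) //= /pt xi.
  by rewrite expr0n (gtn_eqF bx) mul0r.
have : (\val (F D)).@[pt] = 0.
  rewrite FE; pose P (y : toric_ring K h) := (\val y).@[pt] = 0.
  rewrite -/(P _); elim/big_ind: _ => [|y y' Py Py'|e _].
  - by rewrite /P meval0.
  - have -> : P (y + y') = ((\val y + \val y').@[pt] = 0) by [].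
    by rewrite mevalD Py Py' addr0.
  set z := submodule_val f _.
  have -> : P (dbinom K h v 0 e * z) =
      ((\val (dbinom K h v 0 e) * \val z).@[pt] = 0) by [].
  rewrite mevalM; have [_ ->] := val_dbinom K e vL; rewrite raddfMz /=.
  have i1v1 : (v1 == i1) = false by rewrite eq_sym row_neq_col.
  have i2v1 : (v1 == i2) = false by rewrite eq_sym row_neq_col.
  have ji1 : (j == i1) = false by rewrite eq_sym row_neq_col.
  have ji2 : (j == i2) = false by rewrite eq_sym row_neq_col.
  have ce (i : 'I_m) : (i < k)%N -> (c e == i) = false.
    by move=> ik; rewrite eq_sym row_neq_col ?ck.
  have [ri|ri] := eqVneq (r e) i1.
    rewrite (ptX _ i2) ?eqxx ?orbT ?mul0rz ?mul0r // mnmBE hv !mnmDE !mnm1E.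
    by rewrite ri (negPf i12) i2v1 ji2 ce // eqxx.
  rewrite (ptX _ i1) ?eqxx ?mul0rz ?mul0r // mnmBE hv !mnmDE !mnm1E.
  by rewrite (negPf ri) [i2 == i1]eq_sym (negPf i12) i1v1 ji1 ce // eqxx.
rewrite FD mevalM !mevalXU /pt ![v0 == _]eq_sym (negPf i10) (negPf i20).
rewrite ![j == _]eq_sym !row_neq_col // mulr1 => /eqP.
by rewrite oner_eq0.
Qed.

End NotRigid.

Hypothesis v0E : v0 = 0%N :> nat.

(** Pigeonhole on the rows 1, ..., |s| + 1, which leaves out v0 = 0. *)
Lemma row_avoiding (s : seq 'I_m) : ((size s).+1 < k)%N ->
  exists i : 'I_m, [/\ (i < k)%N, i != v0 & i \notin s].
Proof.
move=> sk; have /allPn[x] : ~~ all (mem (map val s)) (iota 1 (size s).+1).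
  apply/negP => /allP/(uniq_leq_size (iota_uniq _ _)).
  by rewrite size_iota size_map ltnn.
rewrite mem_iota => /andP[x1 xs] xNs.
have xm : (x < m)%N by have := ltn_ord v1; lia.
exists (Ordinal xm); split; first by rewrite /=; lia.
  by rewrite -val_eqE /= v0E -lt0n.
by apply: contra xNs => /(map_f val).
Qed.

Lemma col_avoiding (s : seq 'I_m) : (k + size s < v1)%N ->
  exists j : 'I_m, [/\ (k <= j)%N, j != v1 & j \notin s].
Proof.
move=> sk; have /allPn[x] : ~~ all (mem (map val s)) (iota k (size s).+1).
  apply/negP => /allP/(uniq_leq_size (iota_uniq _ _)).
  by rewrite size_iota size_map ltnn.
rewrite mem_iota => /andP[x1 xs] xNs.
have xm : (x < m)%N by have := ltn_ord v1; lia.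
exists (Ordinal xm); split; first by [].
  by rewrite -val_eqE /=; apply/eqP; lia.
by apply: contra xNs => /(map_f val).
Qed.

(** * Extending a graded piece to the free module *)

Section Extension.
Variables (K : fieldType) (a : 'rV[int]_m) (lam : 'rV[int]_n -> K).
Hypothesis lamD : additive_on L lam.
Hypothesis lamS : forall v, v \in L -> lam v != 0 ->
  in_semigroup h (a + mnmz (hdeg h v)).

(** These are the cone conditions on a + h(cycle), where h(cycle) is the sum of the four vertices.
    They are mostly used in contrapositive form, to show that [lam] vanishes on a cycle. *)
Lemma lam_cyc i i' j j' : is_edge i j -> is_edge i' j -> is_edge i j' ->
    is_edge i' j' -> lam (cyc i i' j j') != 0 ->
  [/\ i != i' /\ j != j', rsum a = csum a,
      forall x : 'I_m, (x < k)%N -> 0 <= a 0 x + (i == x)%:Z + (i' == x)%:Z,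
      forall x : 'I_m, (k <= x)%N -> 0 <= a 0 x + (j == x)%:Z + (j' == x)%:Z &
      a 0 v0 + (i == v0)%:Z + (i' == v0)%:Z + (a 0 v1 + (j == v1)%:Z + (j' == v1)%:Z)
        <= rsum a + 2].
Proof.
move=> ij i'j ij' i'j' lam0.
have i_neq : i != i'.
  by apply: contraNneq lam0 => ->; rewrite cyc_rr (additive_on0 lamD).
have j_neq : j != j'.
  by apply: contraNneq lam0 => ->; rewrite cyc_cc (additive_on0 lamD).
have cL := cyc_in ij i'j ij' i'j'.
have /semigroupP[z0 zs zl] := lamS cL lam0.
move: z0 zs zl; rewrite hdeg_cyc //; move: i_neq j_neq.
have [e1 [<- <-]] := rc_surj ij; have [e4 [<- <-]] := rc_surj i'j'.
rewrite -!/(h _) mnmzD !mnmz_U !rsumD !csumD !rsum_hvec !csum_hvec !entryD.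
rewrite !(hvec_row _ v0k) !(hvec_col _ kv1) => i_neq j_neq z0 zs zl.
split=> //.
- by move/addIr: zs.
- by move=> x xk; have := z0 x; rewrite !entryD !hvec_row // addrA.
- by move=> x kx; have := z0 x; rewrite !entryD !hvec_col // addrA.
- by clear -zl; lia.
Qed.

Lemma edge_cone_hvecD e : rsum a = csum a ->
    (forall x : 'I_m, (x < k)%N -> 0 <= a 0 x + (r e == x)%:Z) ->
    (forall x : 'I_m, (k <= x)%N -> 0 <= a 0 x + (c e == x)%:Z) ->
    a 0 v0 + (r e == v0)%:Z + (a 0 v1 + (c e == v1)%:Z) <= rsum a + 1 ->
  edge_cone (a + hvec h e).
Proof.
move=> PQ ar ac al; split=> [x||].
- rewrite entryD; have [xk|kx] := ltnP x k; first by rewrite hvec_row ?ar.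
  by rewrite hvec_col ?ac.
- by rewrite rsumD csumD rsum_hvec csum_hvec PQ.
- by rewrite rsumD rsum_hvec !entryD hvec_row // hvec_col.
Qed.

Definition extendable : Prop := exists cc : 'I_n -> K,
  (forall e, cc e != 0 -> in_semigroup h (a + hvec h e)) /\
  (forall v, v \in L -> lam v = \sum_e cc e *~ v 0 e).

Section Base.
Variables (i j : 'I_m).
Hypotheses (ik : (i < k)%N) (i0 : i != v0) (kj : (k <= j)%N) (j1 : j != v1).

Lemma base_edges e :
  [/\ is_edge (r e) (c e), is_edge i (c e), is_edge (r e) j & is_edge i j].
Proof.
split; [exact: rcP | exact: is_edge_row (ck e) | | exact: is_edge_row].
exact: is_edge_col (rk e) j1 kj.
Qed.

Lemma base_cyc_in e : cyc (r e) i (c e) j \in L.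
Proof. by have [? ? ? ?] := base_edges e; apply: cyc_in. Qed.

Lemma base_lam_cyc e : lam (cyc (r e) i (c e) j) != 0 ->
  [/\ r e != i /\ c e != j, rsum a = csum a,
      forall x : 'I_m, (x < k)%N -> 0 <= a 0 x + (r e == x)%:Z + (i == x)%:Z,
      forall x : 'I_m, (k <= x)%N -> 0 <= a 0 x + (c e == x)%:Z + (j == x)%:Z &
      a 0 v0 + (r e == v0)%:Z + (a 0 v1 + (c e == v1)%:Z) <= rsum a + 2].
Proof.
have [? ? ? ?] := base_edges e => /lam_cyc[] //.
by rewrite (negPf i0) (negPf j1) !addr0.
Qed.

(** Take c_e to be the value on the cycle of e minus the potential. The potential vanishes on L, so
    it may be chosen freely to cancel the values at edges with a + h_e outside the semigroup. *)
Lemma extend_potential (al be : 'I_m -> K) :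
    (forall e, lam (cyc (r e) i (c e) j) != al (r e) + be (c e) ->
       edge_cone (a + hvec h e)) ->
  extendable.
Proof.
move=> H; exists (fun e => lam (cyc (r e) i (c e) j) - (al (r e) + be (c e))).
split=> [e|v vL]; first by rewrite subr_eq0 => /H/semigroupP.
under eq_bigr do rewrite mulrzBl; rewrite sumrB lattice_potential // subr0.
by rewrite {1}(lattice_decomp i j vL) (additive_on_sum lamD) //; apply: base_cyc_in.
Qed.

Lemma extend_zero : (forall e, lam (cyc (r e) i (c e) j) = 0) -> extendable.
Proof.
move=> H; apply: (@extend_potential (fun=> 0) (fun=> 0)) => e.
by rewrite H addr0 eqxx.
Qed.

End Base.

(** There are at least three rows other than v0 and three columns other than v1, so a base row or
    column can avoid two further vertices. *)
Hypotheses (k4 : (3 < k)%N) (m4 : (k.+2 < v1)%N).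

Let pick_row x y : exists i : 'I_m, [/\ (i < k)%N, i != v0, i != x & i != y].
Proof.
have [//|i [ik i0]] := @row_avoiding [:: x; y].
by rewrite !inE negb_or => /andP[ix iy]; exists i.
Qed.

Let pick_col x y : exists j : 'I_m, [/\ (k <= j)%N, j != v1, j != x & j != y].
Proof.
have [|j [kj j1]] := @col_avoiding [:: x; y]; first by rewrite /= addn2.
by rewrite !inE negb_or => /andP[jx jy]; exists j.
Qed.

Lemma extend_unbalanced : rsum a != csum a -> extendable.
Proof.
move=> PQ; have [i [ik i0 _ _]] := pick_row v0 v0.
have [j [kj j1 _ _]] := pick_col v1 v1.
apply: (extend_zero ik i0 kj j1) => e; apply/eqP; apply: contraNT PQ.
by case/(base_lam_cyc ik i0 kj j1) => _ ->.
Qed.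

(** The four vertices of a cycle are distinct, so each coordinate is raised by at most one. *)
Lemma extend_below x : a 0 x < -1 -> extendable.
Proof.
move=> ax; have [i [ik i0 _ _]] := pick_row v0 v0.
have [j [kj j1 _ _]] := pick_col v1 v1.
apply: (extend_zero ik i0 kj j1) => e; apply/eqP; apply: contraTT ax.
case/(base_lam_cyc ik i0 kj j1) => -[ri cj] _ ar ac _; rewrite -leNgt.
have [xk|kx] := ltnP x k.
  have := ar _ xk; case: (eqVneq (r e) x) => [E|];
    case: (eqVneq i x) => [E'|] /=; try lia.
  by rewrite E E' eqxx in ri.
have := ac _ kx; case: (eqVneq (c e) x) => [E|];
  case: (eqVneq j x) => [E'|] /=; try lia.
by rewrite E E' eqxx in cj.
Qed.

(** With a base row avoiding x and y, a cycle can raise only one of the two negative coordinates. *)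
Lemma extend_two_rows (x y : 'I_m) : (x < k)%N -> (y < k)%N -> x != y ->
  a 0 x < 0 -> a 0 y < 0 -> extendable.
Proof.
move=> xk yk xy ax ay; have [i [ik i0 ix iy]] := pick_row x y.
have [j [kj j1 _ _]] := pick_col v1 v1.
apply: (extend_zero ik i0 kj j1) => e; apply/eqP; apply: contraNT xy.
case/(base_lam_cyc ik i0 kj j1) => _ _ ar _ _.
have := ar _ xk; have := ar _ yk; rewrite (negPf ix) (negPf iy).
by case: (eqVneq (r e) x) => [<-|_]; case: (eqVneq (r e) y) => [<-|_];
  rewrite ?eqxx //; lia.
Qed.

Lemma extend_two_cols (x y : 'I_m) : (k <= x)%N -> (k <= y)%N -> x != y ->
  a 0 x < 0 -> a 0 y < 0 -> extendable.
Proof.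
move=> kx ky xy ax ay; have [j [kj j1 jx jy]] := pick_col x y.
have [i [ik i0 _ _]] := pick_row v0 v0.
apply: (extend_zero ik i0 kj j1) => e; apply/eqP; apply: contraNT xy.
case/(base_lam_cyc ik i0 kj j1) => _ _ _ ac _.
have := ac _ kx; have := ac _ ky; rewrite (negPf jx) (negPf jy).
by case: (eqVneq (c e) x) => [<-|_]; case: (eqVneq (c e) y) => [<-|_];
  rewrite ?eqxx //; lia.
Qed.

(** A cycle through v0 or v1 would break the bound on the sum of these two coordinates, so [lam]
    vanishes on it. *)
Lemma extend_deep : rsum a < a 0 v0 + a 0 v1 - 1 -> extendable.
Proof.
move=> al; have [i [ik i0 _ _]] := pick_row v0 v0.
have [j [kj j1 _ _]] := pick_col v1 v1.
have lam0 i1 i2 j1' j2 : is_edge i1 j1' -> is_edge i2 j1' -> is_edge i1 j2 ->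
    is_edge i2 j2 -> [|| i1 == v0, i2 == v0, j1' == v1 | j2 == v1] ->
    lam (cyc i1 i2 j1' j2) = 0.
  move=> e1 e2 e3 e4 E; apply/eqP; apply: contraTT E => /lam_cyc[] // _ _ _ _ le.
  by case: eqP le; case: eqP; case: eqP; case: eqP => //= *; lia.
apply: (extend_zero ik i0 kj j1) => e.
have [b1 b2 b3 b4] := base_edges ik i0 kj j1 e.
have [rv|rv] := eqVneq (r e) v0; first by apply: lam0; rewrite ?rv ?eqxx // -rv.
have [cv|cv] := eqVneq (c e) v1; first by apply: lam0; rewrite ?cv ?eqxx ?orbT // -cv.
have v0c : is_edge v0 (c e) := is_edge_col v0k cv (ck e).
have v0j : is_edge v0 j := is_edge_col v0k j1 kj.
(* A cycle avoiding v0 and v1 is a sum of two cycles through v0. *)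
rewrite -(cyc_trans (r e) v0 i) lamD ?cyc_in //.
by rewrite !lam0 ?addr0 ?eqxx ?orbT.
Qed.

Lemma sum_ge1 (A : pred 'I_m) y : A y ->
  (forall x, A x -> x != y -> 0 <= a 0 x) -> a 0 y <= \sum_(x | A x) a 0 x.
Proof.
move=> Ay H; rewrite (bigD1 y) //= lerDl; apply: sumr_ge0 => x /andP[].
exact: H.
Qed.

Lemma sum_ge2 (A : pred 'I_m) y y' : A y -> A y' -> y != y' ->
    (forall x, A x -> x != y -> x != y' -> 0 <= a 0 x) ->
  a 0 y + a 0 y' <= \sum_(x | A x) a 0 x.
Proof.
move=> Ay Ay' yy' H; rewrite (bigD1 y) //= (bigD1 y') /=; last first.
  by rewrite Ay' eq_sym.
by rewrite addrA lerDl; apply: sumr_ge0 => x /andP[/andP[]]; apply: H.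
Qed.

Section Regular.
Hypotheses (PQ : rsum a = csum a) (a1 : forall x, -1 <= a 0 x).
Hypothesis al : a 0 v0 + a 0 v1 - 1 <= rsum a.

(** Only edges at v0 or v1 can leave the cone. [be] cancels the values on row v0 and [al] those on
    column v1, without conflict since {v0, v1} is not an edge. *)
Lemma extend_nonneg : (forall x, 0 <= a 0 x) -> extendable.
Proof.
move=> a0; have [i [ik i0 _ _]] := pick_row v0 v0.
have [j [kj j1 _ _]] := pick_col v1 v1.
apply: (extend_potential ik i0 kj j1
  (al := fun x => if x == v0 then 0 else lam (cyc x i v1 j))
  (be := fun x => if x == v1 then 0 else lam (cyc v0 i x j))) => e.
have := rcP e; rewrite /is_edge => /and3P[_ _].
have [->|rv] := eqVneq (r e) v0; have [->|cv] := eqVneq (c e) v1;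
  rewrite /= ?add0r ?addr0 ?eqxx // => _ _.
apply: edge_cone_hvecD => // [x _|x _|]; rewrite ?addr_ge0 //.
rewrite (negPf rv) (negPf cv); lia.
Qed.

(** As the base row avoids i1, values outside row i1 vanish. In row i1 only the edge to v1 may leave
    the cone, and a constant shift of the row cancels its value. *)
Lemma extend_one_row (i1 : 'I_m) : (i1 < k)%N -> a 0 i1 < 0 ->
    (forall x : 'I_m, x != i1 -> 0 <= a 0 x) -> extendable.
Proof.
move=> i1k ai1 a0; have [i [ik i0 ii1 _]] := pick_row i1 i1.
have [j [kj j1 _ _]] := pick_col v1 v1.
apply: (extend_potential ik i0 kj j1
  (al := fun x => if (x == i1) && (i1 != v0) then lam (cyc x i v1 j) else 0)
  (be := fun=> 0)) => e; rewrite addr0.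
have [ri|ri] := eqVneq (r e) i1; last first.
  case/(base_lam_cyc ik i0 kj j1) => _ _ /(_ _ i1k).
  by rewrite (negPf ri) (negPf ii1); lia.
have := rcP e; rewrite /is_edge => /and3P[_ _].
have [->|cv _ _] := eqVneq (c e) v1.
  by rewrite andbT ri => ->; rewrite eqxx.
have ai1' := a1 i1.
have av1 : a 0 v1 <= csum a.
  by apply: sum_ge1 => // x kx _; apply: a0; rewrite eq_sym row_neq_col.
apply: edge_cone_hvecD => // [x xk|x kx|].
- rewrite ri; have [<-|/eqP xi] := eqVneq i1 x; first lia.
  by rewrite addr0 a0 // eq_sym; apply/eqP.
- by rewrite addr_ge0 // a0 // eq_sym row_neq_col.
- by rewrite ri (negPf cv); have [E|_] := eqVneq i1 v0; [move: ai1 ai1'; rewrite E|]; lia.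
Qed.

Lemma extend_one_col (j2 : 'I_m) : (k <= j2)%N -> a 0 j2 < 0 ->
    (forall x : 'I_m, x != j2 -> 0 <= a 0 x) -> extendable.
Proof.
move=> kj2 aj2 a0; have [j [kj j1 jj2 _]] := pick_col j2 j2.
have [i [ik i0 _ _]] := pick_row v0 v0.
apply: (extend_potential ik i0 kj j1 (al := fun=> 0)
  (be := fun x => if (x == j2) && (j2 != v1) then lam (cyc v0 i x j) else 0)) => e.
rewrite add0r.
have [cj|cj] := eqVneq (c e) j2; last first.
  case/(base_lam_cyc ik i0 kj j1) => _ _ _ /(_ _ kj2).
  by rewrite (negPf cj) (negPf jj2); lia.
have := rcP e; rewrite /is_edge => /and3P[_ _].
have [->|rv _ _] := eqVneq (r e) v0.
  by rewrite /= cj => ->; rewrite eqxx.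
have aj2' := a1 j2.
have av0 : a 0 v0 <= rsum a.
  by apply: sum_ge1 => // x xk _; apply: a0; rewrite row_neq_col.
apply: edge_cone_hvecD => // [x xk|x kx|].
- by rewrite addr_ge0 // a0 // row_neq_col.
- rewrite cj; have [<-|/eqP xj] := eqVneq j2 x; first lia.
  by rewrite addr0 a0 // eq_sym; apply/eqP.
- by rewrite cj (negPf rv); have [E|_] := eqVneq j2 v1; [move: aj2 aj2'; rewrite E|]; lia.
Qed.

(** Only the edge {i1, j2} can carry a nonzero value, and in that case a + h_e already lies in the
    cone. *)
Lemma extend_row_col (i1 j2 : 'I_m) : (i1 < k)%N -> (k <= j2)%N ->
    a 0 i1 < 0 -> a 0 j2 < 0 ->
    (forall x : 'I_m, x != i1 -> x != j2 -> 0 <= a 0 x) -> extendable.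
Proof.
move=> i1k kj2 ai1 aj2 a0; have [j [kj j1 jj2 _]] := pick_col j2 j2.
have [i [ik i0 ii1 _]] := pick_row i1 i1.
apply: (extend_potential ik i0 kj j1 (al := fun=> 0) (be := fun=> 0)) => e.
rewrite addr0 => /(base_lam_cyc ik i0 kj j1)[_ _ ar ac _].
have ri : r e = i1.
  by apply: contraTeq (ar _ i1k) => /negPf ->; rewrite (negPf ii1); lia.
have cj : c e = j2.
  by apply: contraTeq (ac _ kj2) => /negPf ->; rewrite (negPf jj2); lia.
have := a1 i1; have := a1 j2 => aj2' ai1'.
have := rcP e; rewrite /is_edge ri cj => /and3P[_ _ NE].
apply: edge_cone_hvecD => // [x xk|x kx|].
- rewrite ri; have [<-|/eqP xi] := eqVneq i1 x; first lia.
  by rewrite addr0; apply: a0; [rewrite eq_sym; apply/eqP | rewrite row_neq_col].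
- rewrite cj; have [<-|/eqP xj] := eqVneq j2 x; first lia.
  rewrite addr0; apply: a0; first by rewrite eq_sym row_neq_col.
  by rewrite eq_sym; apply/eqP.
rewrite ri cj; move: NE.
have [iv|i1v] := eqVneq i1 v0; have [jv|jv] := eqVneq j2 v1 => //= _; last lia.
  have : a 0 v1 + a 0 j2 <= csum a.
    apply: sum_ge2; rewrite 1?eq_sym // => x kx _ xj.
    by apply: a0 => //; rewrite eq_sym row_neq_col.
  by move: ai1; rewrite iv; lia.
have : a 0 v0 + a 0 i1 <= rsum a.
  apply: sum_ge2; rewrite 1?eq_sym // => x xk _ xi.
  by apply: a0 => //; rewrite row_neq_col.
by move: aj2; rewrite jv; lia.
Qed.

End Regular.

(** Once the degenerate degrees are removed, at most one row and one column coordinate are negative,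
    which leaves the four regular cases. *)
Lemma rigid_extension : extendable.
Proof.
have [PQ|/extend_unbalanced//] := eqVneq (rsum a) (csum a).
have [/existsP[x /extend_below//]|/existsPn a1] := boolP [exists x, a 0 x < -1].
have {}a1 x : -1 <= a 0 x by have := a1 x; rewrite -leNgt.
have [/extend_deep//|al] := ltrP (rsum a) (a 0 v0 + a 0 v1 - 1).
have [/existsP[i /andP[ik ai]]|/existsPn ar] :=
    boolP [exists i : 'I_m, (i < k)%N && (a 0 i < 0)];
  have [/existsP[j /andP[kj aj]]|/existsPn ac] :=
    boolP [exists j : 'I_m, (k <= j)%N && (a 0 j < 0)].
- have [/existsP[x /and3P[xk xi ax]]|/existsPn ar] :=
    boolP [exists x : 'I_m, [&& (x < k)%N, x != i & a 0 x < 0]].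
    exact: extend_two_rows xk ik xi ax ai.
  have [/existsP[x /and3P[kx xj ax]]|/existsPn ac] :=
    boolP [exists x : 'I_m, [&& (k <= x)%N, x != j & a 0 x < 0]].
    exact: extend_two_cols kx kj xj ax aj.
  apply: (extend_row_col PQ a1 al ik kj ai aj) => x xi xj; rewrite leNgt.
  have [xk|kx] := ltnP x k; first by have := ar x; rewrite xk xi.
  by have := ac x; rewrite kx xj.
- have [/existsP[x /and3P[xk xi ax]]|/existsPn ar] :=
    boolP [exists x : 'I_m, [&& (x < k)%N, x != i & a 0 x < 0]].
    exact: extend_two_rows xk ik xi ax ai.
  apply: (extend_one_row PQ a1 al ik ai) => x xi; rewrite leNgt.
  have [xk|kx] := ltnP x k; first by have := ar x; rewrite xk xi.
  by have := ac x; rewrite kx.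
- have [/existsP[x /and3P[kx xj ax]]|/existsPn ac] :=
    boolP [exists x : 'I_m, [&& (k <= x)%N, x != j & a 0 x < 0]].
    exact: extend_two_cols kx kj xj ax aj.
  apply: (extend_one_col PQ a1 al kj aj) => x xj; rewrite leNgt.
  have [xk|kx] := ltnP x k; first by have := ar x; rewrite xk.
  by have := ac x; rewrite kx xj.
apply: (extend_nonneg PQ al) => x; rewrite leNgt.
have [xk|kx] := ltnP x k; first by have := ar x; rewrite xk.
by have := ac x; rewrite kx.
Qed.

End Extension.

Lemma edge_toric_rigid (K : fieldType) : (3 < k)%N -> (k.+2 < v1)%N ->
  toric_rigid K h.
Proof.
move=> k4 m4.
have [|i [ik i0 _]] := @row_avoiding [::]; first by rewrite /=; lia.
have [|j [kj j1 _]] := @col_avoiding [::]; first by rewrite /=; lia.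
apply: (@toric_rigidP _ _ _ _ (fun e => cyc (r e) i (c e) j)).
- by move=> e; apply: base_cyc_in.
- by move=> v; apply: lattice_decomp.
by move=> a lam lamD lamS; apply: rigid_extension.
Qed.

(** * Inseparability of the bipartite relation lattice *)

Lemma hdeg_cyc_row (i i' j j' x : 'I_m) : is_edge i j -> is_edge i' j' ->
  (x < k)%N -> x != i -> x != i' -> hdeg h (cyc i i' j j') x = 0%N.
Proof.
move=> ij i'j' xk xi xi'.
have h0 : hdeg h 0 x = 0%N.
  by rewrite hdegE mnm_sumE big1 // => e _; rewrite mxE mulmnE muln0.
have [->|ii'] := eqVneq i i'; first by rewrite cyc_rr.
have [->|jj'] := eqVneq j j'; first by rewrite cyc_cc.
rewrite hdeg_cyc // !mnmDE !mnm1E ![_ == x]eq_sym (negPf xi) (negPf xi').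
have /and3P[_ kj _] := ij; have /and3P[_ kj' _] := i'j'.
by rewrite !row_neq_col.
Qed.

Lemma hdeg_cyc_col (i i' j j' x : 'I_m) : is_edge i j -> is_edge i' j' ->
  (k <= x)%N -> x != j -> x != j' -> hdeg h (cyc i i' j j') x = 0%N.
Proof.
move=> ij i'j' kx xj xj'.
have h0 : hdeg h 0 x = 0%N.
  by rewrite hdegE mnm_sumE big1 // => e _; rewrite mxE mulmnE muln0.
have [->|ii'] := eqVneq i i'; first by rewrite cyc_rr.
have [->|jj'] := eqVneq j j'; first by rewrite cyc_cc.
rewrite hdeg_cyc // !mnmDE !mnm1E [j == x]eq_sym [j' == x]eq_sym.
rewrite (negPf xj) (negPf xj').
have /and3P[ik _ _] := ij; have /and3P[ik' _ _] := i'j'.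
by rewrite !row_neq_col.
Qed.

(** The base avoids both ends of e0, so the cycle of any other edge misses the row or the column of
    e0. *)
Lemma edge_inseparable (K : fieldType) : (2 < k)%N -> (k.+1 < v1)%N ->
  inseparable K L.
Proof.
move=> k3 m3 e0.
have [//|i [ik i0]] := @row_avoiding [:: r e0]; rewrite inE => ir.
have [|j [kj j1]] := @col_avoiding [:: c e0]; first by rewrite addn1.
rewrite inE => jc.
apply: (@inseparable_at _ _ _ _ e0 (fun e => cyc (r e) i (c e) j)).
- by move=> e; apply: base_cyc_in.
- by move=> v; apply: lattice_decomp.
move=> e ee0; have [b1 b2 b3 b4] := base_edges ik i0 kj j1 e.
have [rE|rN] := eqVneq (r e) (r e0); last first.
  exists (r e0); split; first by rewrite mnmDE mnm1E eqxx.
  by rewrite hdeg_cyc_row ?rk // eq_sym.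
exists (c e0); split; first by rewrite mnmDE [U_(c e0)%MM _]mnm1E eqxx addn1.
rewrite hdeg_cyc_col ?ck // eq_sym //.
by apply: contra ee0 => /eqP cE; apply/eqP/rc_inj.
Qed.

End Bipartite.

(** An edge, given as a set, has exactly one end below k, so its row and column are determined. *)
Lemma bip_labelling (m k : nat) (v0 v1 : 'I_m) : v0 = 0 :> nat -> v1 = m.-1 :> nat ->
  let n := #|edges (bip_minus_edge k m)| in
  exists r c : 'I_n -> 'I_m,
    [/\ forall e, is_edge k v0 v1 (r e) (c e),
        forall e f, r e = r f -> c e = c f -> e = f,
        forall i j, is_edge k v0 v1 i j -> exists e, r e = i /\ c e = j &
        @edge_gens m (bip_minus_edge k m) = edge_mon r c].
Proof.
move=> v0E v1E n.
have edgeE i j : is_edge k v0 v1 i j =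
    [&& i < k, k <= j & ~~ ((i == 0 :> nat) && (j == m.-1 :> nat))].
  by rewrite /is_edge -!val_eqE /= v0E v1E.
have ends (e : 'I_n) : exists p : 'I_m * 'I_m,
    is_edge k v0 v1 p.1 p.2 /\ enum_val e = [set p.1; p.2].
  have := enum_valP e; case/imset2P => i j; rewrite !inE => ik kj ->.
  by exists (i, j); rewrite edgeE /= ik kj.
have [p pP] := choice ends.
have pk e : (p e).1 < k <= (p e).2 by have [/and3P[-> ->]] := pP e.
exists (fun e => (p e).1), (fun e => (p e).2); split.
- by move=> e; have [] := pP e.
- move=> e f rE cE; apply: enum_val_inj.
  by have [_ ->] := pP e; have [_ ->] := pP f; rewrite rE cE.
- move=> i j ij; have ijE : [set i; j] \in edges (bip_minus_edge k m).
    move: ij; rewrite edgeE => /and3P[ik kj ij].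
    by apply/imset2P; exists i j; rewrite ?inE ?ik ?kj.
  pose e := enum_rank_in ijE [set i; j]; exists e.
  have [_] := pP e; rewrite enum_rankK_in // => E.
  have /and3P[ik kj _] := ij; have /andP[pik kpj] := pk e.
  have : (p e).1 \in [set i; j] by rewrite E !inE eqxx.
  have : (p e).2 \in [set i; j] by rewrite E !inE eqxx orbT.
  rewrite !inE => /orP[/eqP E2|/eqP->]; first by rewrite E2 leqNgt ik in kpj.
  by move=> /orP[/eqP->//|/eqP E1]; rewrite E1 ltnNge kj in pik.
apply/funext => e; rewrite /edge_gens /edge_mon; have [_ ->] := pP e.
rewrite big_setU1 ?big_set1 // inE; apply/eqP => E.
by have := pk e; rewrite E ltnNge; case: leqP.
Qed.

Theorem proposition7p1 (K : fieldType) (charK : [pchar K]%R =i pred0)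
    (k m : nat) :
  (k = 3 -> m - k = 3 ->
     edge_ring_inseparable K (bip_minus_edge k m) /\
     ~ edge_ring_rigid K (bip_minus_edge k m)) /\
  (4 <= k -> k <= m - k -> edge_ring_rigid K (bip_minus_edge k m)).
Proof.
split=> [k3 mk3|k4 mk].
  have m6 : m = 6 by lia.
  have mpos : 0 < m by rewrite m6.
  have m1 : m.-1 < m by rewrite ltn_predL.
  pose v0 := Ordinal mpos; pose v1 := Ordinal m1.
  have [r [c [rcP rc_inj rc_surj hE]]] :=
    @bip_labelling m k v0 v1 (erefl _) (erefl _).
  have v0k : v0 < k by rewrite k3.
  have kv1 : k <= v1 by rewrite /= k3 m6.
  split; first by rewrite /edge_ring_inseparable /toric_inseparable hE;
    apply: (@edge_inseparable _ _ k r c v0 v1); rewrite //= ?k3 ?m6.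
  (* Ordinals count from 0: the rows i1, i2 are the vertices 2, 3, the column j is vertex 4, and [e]
     is the edge {2, 6}. *)
  have m2 : 1 < m by rewrite m6.
  have m3 : 2 < m by rewrite m6.
  have m4 : 3 < m by rewrite m6.
  have [e [re ce]] : exists e, r e = Ordinal m2 /\ c e = v1.
    by apply: rc_surj; rewrite /is_edge kv1 /= k3.
  rewrite /edge_ring_rigid hE.
  apply: (@edge_not_rigid _ _ k r c v0 v1 v0k kv1 rcP rc_inj rc_surj K
    (Ordinal m2) (Ordinal m3) _ _ _ _ _ _ (Ordinal m4) _ _ e) => //; rewrite ?k3 //=.
    move=> x; rewrite -!val_eqE /=; lia.
  by rewrite -val_eqE /= m6.
have m1 : m.-1 < m by lia.
have mpos : 0 < m by lia.
have [r [c [rcP rc_inj rc_surj hE]]] :=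
  @bip_labelling m k (Ordinal mpos) (Ordinal m1) (erefl _) (erefl _).
rewrite /edge_ring_rigid hE.
apply: (@edge_toric_rigid _ _ k r c (Ordinal mpos) (Ordinal m1)) => //=; lia.
Qed.
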